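(* Let $F$ be the random subset of the self-similar set $\Lambda$ described in the context, generated by an IFS $\{f_1,\dots,f_N\}$ with contraction ratios $r_1,\dots,r_N$, an integer $M\ge 2$, and a probability vector $\mathbf{p}=(p_1,\dots,p_N)\in(0,1)^N$. Let $s_0$ and $\tilde{s}$ be the unique real numbers satisfying $$\sum_{i=1}^N r_i^{s_0}=1,\qquad \sum_{i=1}^N p_i r_i^{\tilde{s}}=\frac1M.$$ The Hausdorff dimension of $F$ is determined as follows: (i) If $\sum_{i=1}^N r_i^{s_0}\log(Mp_i)\geq 0$, then $\dim_H F=s_0$, $\mathbb{P}$-almost surely. (ii) If $\sum_{i=1}^N p_i r_i^{\tilde{s}}\log(Mp_i)\leq 0$, then $\dim_H F=\tilde{s}\leq s_0$, $\mathbb{P}$-almost surely, with equality $\tilde{s}=s_0$ if and only if $M=N$ and $p_i=1/N$ for $i=1,\dots,N$. (iii) If $$\sum_{i=1}^N r_i^{s_0}\log(Mp_i)<0<\sum_{i=1}^N p_i r_i^{\tilde{s}}\log(Mp_i),$$ then there is a unique pair $(\hat{s},\hat{t})$ of real numbers, with $\hat{s}>0$, satisfying the equations $$\sum_{i=1}^N r_i^{\hat{s}}(Mp_i)^{\hat{t}}=1,\qquad \sum_{i=1}^N r_i^{\hat{s}}(Mp_i)^{\hat{t}}\log(Mp_i)=0,$$ and $\dim_H F=\hat{s}<s_0$, $\mathbb{P}$-almost surely.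
   Context: Logarithms are natural. $\dim_H$ denotes Hausdorff dimension. Setup: $N\ge2$, $d\ge 1$, and $f_1,\dots,f_N:\mathbb{R}^d\to\mathbb{R}^d$ are similarities with contraction ratios $r_i\in(0,1)$, i.e. $|f_i(x)-f_i(y)|=r_i|x-y|$. It is assumed that there is a non-empty bounded open set $U\subset\mathbb{R}^d$ such that (O1) $f_i(U)\subset U$ for all $i$; (O2) $f_i(U)\cap f_j(U)=\emptyset$ for all $i\ne j$; (O3) $U$ is the interior of its closure. $\Lambda$ is the attractor, i.e. the unique non-empty compact set with $\Lambda=\bigcup_{i=1}^N f_i(\Lambda)$. Random subset: $M\geq 2$ is an integer and $\mathbf{p}=(p_1,\dots,p_N)\in(0,1)^N$ satisfies $\sum_i p_i=1$. Consider the full infinite $M$-ary tree (rooted tree in which every vertex has exactly $M$ children) with edge set $E$. Under $\mathbb{P}$, the edge labels $\omega(e)$, $e\in E$, are independent with values in $\{1,\dots,N\}$ and $\mathbb{P}(\omega(e)=i)=p_i$. $\mathcal{P}$ is the set of infinite paths starting at the root (moving away from the root), $P(k)$ is the $k$-th edge of $P\in\mathcal{P}$, and $$F=F(\omega):=\Big\{\lim_{n\to\infty} f_{\omega(P(1))}\circ\dots\circ f_{\omega(P(n))}(0): P\in\mathcal{P}\Big\}\subset\Lambda.$$ *)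

(* Defs.v *)
From HB Require Import structures.
From mathcomp Require Import all_boot all_order all_algebra.
From mathcomp Require Import all_classical all_reals all_analysis.

Set Implicit Arguments.
Unset Strict Implicit.
Unset Printing Implicit Defensive.

Import Order.TTheory GRing.Theory Num.Theory.
Import numFieldNormedType.Exports.

Local Open Scope classical_set_scope.
Local Open Scope ring_scope.

(* The norm `|x| of the library on 'rV[R]_d is the sup norm: it induces the
   same topology and the same bounded sets as the Euclidean norm, but
   similarities and diameters must be taken with respect to the latter. *)
Definition enorm (R : realType) (d : nat) (x : 'rV[R]_d) : R :=
  Num.sqrt (\sum_(j < d) x ord0 j ^+ 2).

Definition diam (R : realType) (d : nat) (A : set 'rV[R]_d) : \bar R :=
  ereal_sup [set (enorm (x - y))%:E | x in A & y in A].

(* (diam A)^s, with the usual convention that the empty set has weight 0 for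
   every s, including s = 0. *)
Definition diam_pow (R : realType) (d : nat) (s : R) (A : set 'rV[R]_d) :
    \bar R :=
  (if A == set0 then 0 else poweR (diam A) s)%E.

Definition hausdorff_premeasure (R : realType) (d : nat) (s delta : R)
    (A : set 'rV[R]_d) : \bar R :=
  ereal_inf [set (\sum_(0 <= k <oo) diam_pow s (C k))%E |
    C in [set C : nat -> set 'rV[R]_d |
      A `<=` \bigcup_k C k /\ forall k, (diam (C k) <= delta%:E)%E]].

Definition hausdorff_measure (R : realType) (d : nat) (s : R)
    (A : set 'rV[R]_d) : \bar R :=
  ereal_sup [set hausdorff_premeasure s delta A |
    delta in [set delta : R | 0 < delta]].

Definition hausdorff_dim (R : realType) (d : nat) (A : set 'rV[R]_d) : \bar R :=
  ereal_inf [set s%:E | s in [set s : R | 0 <= s /\ hausdorff_measure s A = 0%E]].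

Definition similarity (R : realType) (d : nat) (r : R)
    (f : 'rV[R]_d -> 'rV[R]_d) : Prop :=
  forall x y, enorm (f x - f y) = r * enorm (x - y).

Definition open_set_condition (R : realType) (d N : nat)
    (f : 'I_N -> 'rV[R]_d -> 'rV[R]_d) : Prop :=
  exists U : set 'rV[R]_d,
    [/\ U !=set0, bounded_set U & open U] /\
    [/\ forall i, f i @` U `<=` U,
        forall i j, i != j -> (f i @` U) `&` (f j @` U) = set0
      & U = interior (closure U)].

(* Vertices of the M-ary tree are the finite words over 'I_M, the root being
   [::]. The edge (v, j) joins the vertex v to its j-th child rcons v j. *)
Definition edge (M : nat) : Type := (seq 'I_M * 'I_M)%type.

(* P k is the (k+1)-st edge of the path. *)
Definition root_path (M : nat) (P : nat -> edge M) : Prop :=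
  (P 0).1 = [::] /\ forall k, (P k.+1).1 = rcons (P k).1 (P k).2.

Definition random_subset (R : realType) (d N M : nat)
    (f : 'I_N -> 'rV[R]_d -> 'rV[R]_d) (w : edge M -> 'I_N) :
    set 'rV[R]_d :=
  [set x | exists2 P : nat -> edge M, root_path P &
    (fun n => foldr f 0 (mkseq (fun k => w (P k)) n)) @ \oo --> x].

(* Mutual independence of variables with values in a finite type V carrying
   the discrete sigma-algebra, so that every B e : set V is an event. *)
Definition mutually_independent (disp : measure_display)
    (T : measurableType disp) (R : realType) (Pr : probability T R)
    (I : eqType) (V : finType) (X : I -> T -> V) : Prop :=
  forall (s : seq I) (B : I -> set V), uniq s ->
    Pr (\bigcap_(e in [set` s]) (X e @^-1` B e)) =
    (\prod_(e <- s) Pr (X e @^-1` B e))%E.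

Definition iid_labels (disp : measure_display)
    (T : measurableType disp) (R : realType) (Pr : probability T R)
    (N M : nat) (p : 'I_N -> R) (omega : edge M -> T -> 'I_N) : Prop :=
  [/\ forall e (B : set 'I_N), measurable (omega e @^-1` B),
      mutually_independent Pr omega
    & forall e i, Pr (omega e @^-1` [set i]) = (p i)%:E].

(* Main.v *)
Require Import Defs.
From HB Require Import structures.
From mathcomp Require Import all_boot all_order all_algebra.
From mathcomp Require Import all_classical all_reals all_analysis.
From mathcomp Require Import ring lra.

Set Implicit Arguments.
Unset Strict Implicit.
Unset Printing Implicit Defensive.

Import Order.TTheory GRing.Theory Num.Theory.
Import numFieldNormedType.Exports.

Local Open Scope classical_set_scope.
Local Open Scope ring_scope.

(** Write x_i = M p_i and let the pressure be sum_i r_i^s x_i^t.  For each t the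
    equation [pressure s t = 1] has one solution s(t), and the claim is that
    almost surely the dimension of F is the minimum of s over [0, 1].  Here
    s(0) = s0 and s(1) is the exponent of case (ii); implicit differentiation
    shows that the sign of s'(t) is that of sum_i r_i^s x_i^t ln x_i, so the three
    cases say that the minimum is at t = 0, at t = 1, or at an interior critical
    point.  [random_dim_ae] treats them together: t is a minimiser as soon as the
    derivative a at (s(t), t) satisfies t a <= 0 <= (1 - t) a.

    Upper bound.  A word x of length n labels some path from the root with
    probability at most min(1, M^n p_x) <= (M^n p_x)^t, so the words that occur
    give covers of F whose expected weight with exponent s' is at most the n-th
    power of [pressure s' t], which tends to 0 when s' > s(t)
    ([measure_eq0_ae]).

    Lower bound.  Fix s' < s(t) and let q_i = r_i^s(t) x_i^t, a probability
    vector.  Take all words of one length whose letter frequencies are close to q: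
    there are B of them, all of ratio rho, and each labels mu descendants on
    average.  By Stirling's formula the choice of q makes both B and B mu larger
    than rho^-s'.  Group these words into about B min(1, mu) colours so that each
    colour has at least two descendants on average ([colour_family]).  A sequence
    of colours of any length then survives with a probability bounded away from 0
    ([colour_step], a second moment estimate).  If each vertex first branches
    freely for a number of generations logarithmic in j, then with large
    probability all colour words of length j are found below it at once, and by
    induction on the depth a regular tree of pairwise distinct words grows from a
    vertex with probability bounded below ([word_tree_ae]); independence of
    disjoint subtrees makes such a vertex exist almost surely
    ([infinite_tree_ae]).

    Finally, such a tree carries a mass distribution, the image of Lebesgue
    measure on [0, 1[ under the expansion of a number into digits
    ([mass_distribution]).  By the open set condition a set of diameter D meets few
    of the cylinders of size about D ([few_nodes]), so it has mass O(D^s') and the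
    s'-dimensional measure of F is positive ([coded_set_dim]).

    The statements about the exponents themselves all follow from the convexity
    of the pressure, in the form of the tangent plane inequality
    [pressure_tangent]. *)

(** * The Euclidean norm and similarities *)

Section EuclideanNorm.
Variables (R : realType) (d : nat).
Implicit Types x y z : 'rV[R]_d.

Definition dot x y : R := \sum_(j < d) x ord0 j * y ord0 j.

Lemma dotC x y : dot x y = dot y x.
Proof. by apply: eq_bigr => j _; rewrite mulrC. Qed.

Lemma dotBl x y z : dot (x - y) z = dot x z - dot y z.
Proof. by rewrite /dot -sumrB; apply: eq_bigr => j _; rewrite !mxE mulrBl. Qed.

Lemma dotBr x y z : dot x (y - z) = dot x y - dot x z.
Proof. by rewrite dotC dotBl !(dotC _ x). Qed.

Lemma enorm_ge0 x : 0 <= enorm x. Proof. exact: sqrtr_ge0. Qed.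

Lemma sqr_enorm x : enorm x ^+ 2 = dot x x.
Proof.
rewrite sqr_sqrtr; first by apply: eq_bigr => j _; rewrite expr2.
by apply: sumr_ge0 => j _; rewrite sqr_ge0.
Qed.

Lemma enorm0 : enorm (0 : 'rV[R]_d) = 0.
Proof.
rewrite /enorm big1 ?sqrtr0// => j _; by rewrite mxE expr0n.
Qed.

Lemma enormN x : enorm (- x) = enorm x.
Proof. by rewrite /enorm; congr Num.sqrt; apply: eq_bigr => j _; rewrite mxE sqrrN. Qed.

Lemma enormBC x y : enorm (x - y) = enorm (y - x).
Proof. by rewrite -enormN opprB. Qed.

Lemma enorm_coord x j : `|x ord0 j| <= enorm x.
Proof.
rewrite -sqrtr_sqr ler_wsqrtr// (bigD1 j)//= lerDl.
by apply: sumr_ge0 => i _; rewrite sqr_ge0.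
Qed.

Lemma enorm_eq0 x : enorm x = 0 -> x = 0.
Proof.
move=> x0; apply/rowP => j; rewrite mxE; apply/eqP; rewrite -normr_le0 -x0.
exact: enorm_coord.
Qed.

(** Cauchy-Schwarz: the squared length of [b x - a y] is nonnegative, where [a] and
    [b] are the norms of [x] and [y]. *)
Lemma dot_le x y : dot x y <= enorm x * enorm y.
Proof.
have [x0|x0] := eqVneq (enorm x) 0.
  rewrite x0 mul0r (enorm_eq0 x0) /dot big1// => j _; by rewrite mxE mul0r.
have [y0|y0] := eqVneq (enorm y) 0.
  rewrite y0 mulr0 (enorm_eq0 y0) /dot big1// => j _; by rewrite mxE mulr0.
have a0 : 0 < enorm x by rewrite lt_neqAle eq_sym x0 enorm_ge0.
have b0 : 0 < enorm y by rewrite lt_neqAle eq_sym y0 enorm_ge0.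
have xx := sqr_enorm x; have yy := sqr_enorm y.
set a := enorm x in a0 xx *; set b := enorm y in b0 yy *.
have : 0 <= \sum_(j < d) (b * x ord0 j - a * y ord0 j) ^+ 2.
  by apply: sumr_ge0 => i _; rewrite sqr_ge0.
have -> : \sum_(j < d) (b * x ord0 j - a * y ord0 j) ^+ 2
    = b ^+ 2 * dot x x - 2 * a * b * dot x y + a ^+ 2 * dot y y.
  rewrite /dot !mulr_sumr -sumrB -big_split/=; apply: eq_bigr => j _; ring.
rewrite -xx -yy.
have -> : b ^+ 2 * a ^+ 2 - 2 * a * b * dot x y + a ^+ 2 * b ^+ 2 =
  (2 * a * b) * (a * b - dot x y) by ring.
by rewrite pmulr_rge0 ?mulr_gt0// subr_ge0.
Qed.

Lemma enormD x y : enorm (x + y) <= enorm x + enorm y.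
Proof.
rewrite -(@ler_pXn2r _ 2) ?nnegrE ?addr_ge0 ?enorm_ge0//.
rewrite sqr_enorm sqrrD !sqr_enorm.
have -> : dot (x + y) (x + y) = dot x x + dot x y *+ 2 + dot y y.
  rewrite mulr2n /dot -!big_split/=; apply: eq_bigr => j _; rewrite mxE; ring.
by rewrite lerD2r lerD2l lerMn2r dot_le orbT.
Qed.

Lemma enormB x y : enorm (x - y) <= enorm x + enorm y.
Proof. by rewrite -(enormN y) enormD. Qed.

Lemma enorm_trans x y z : enorm (x - z) <= enorm (x - y) + enorm (y - z).
Proof. by apply: le_trans (enormD _ _); rewrite addrA subrK. Qed.

Lemma norm_le_enorm x : `|x| <= enorm x.
Proof.
rewrite /Num.norm/= mx_normrE; apply/bigmax_leP; split=> [|[i j] _ /=].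
  exact: enorm_ge0.
by rewrite ord1 enorm_coord.
Qed.

Lemma enorm_le_sup x c : 0 <= c -> (forall j, `|x ord0 j| <= c) ->
  enorm x <= Num.sqrt d%:R * c.
Proof.
move=> c0 xc; rewrite -{1}(ger0_norm c0) -sqrtr_sqr -sqrtrM ?ler0n//.
rewrite ler_wsqrtr//.
apply: (@le_trans _ _ (\sum_(j < d) c ^+ 2)).
  by apply: ler_sum => j _; rewrite -real_normK ?num_real// lerXn2r ?nnegrE.
by rewrite sumr_const card_ord mulr_natl.
Qed.

Lemma enorm_le_norm x : enorm x <= Num.sqrt d%:R * `|x|.
Proof.
apply: enorm_le_sup => // j.
rewrite {2}/Num.norm/= mx_normrE.
exact: (le_bigmax _ (fun ij : 'I_1 * 'I_d => `|x ij.1 ij.2|) (ord0, j)).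
Qed.

(** The topology is that of the sup norm, which the Euclidean norm exceeds by at
    most a factor [sqrt d]. *)
Lemma enorm_cvg_le (u : nat -> 'rV[R]_d) (x y : 'rV[R]_d) c :
  u @ \oo --> x -> (\forall n \near \oo, enorm (u n - y) <= c) ->
  enorm (x - y) <= c.
Proof.
move=> ux uc; apply/ler_addgt0Pr => e e0.
pose k : R := Num.sqrt d%:R + 1.
have k0 : 0 < k by rewrite ltr_wpDl ?sqrtr_ge0.
have e1 : 0 < e / k by rewrite divr_gt0.
move/cvgrPdist_lt : ux => /(_ _ e1) ux.
near \oo => n.
have h1 : enorm (u n - y) <= c by near: n.
have h2 : `|x - u n| < e / k by near: n.
rewrite (le_trans (enorm_trans x (u n) y))// addrC lerD//.
rewrite (le_trans (enorm_le_norm _))//.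
apply: (@le_trans _ _ (k * (e / k))).
  by apply: ler_pM; rewrite ?sqrtr_ge0// ?lerDl// ltW.
by rewrite mulrC divfK// gt_eqF.
Unshelve. all: by end_near. Qed.

End EuclideanNorm.

Section Similarity.
Variables (R : realType) (d : nat) (r : R) (f : 'rV[R]_d -> 'rV[R]_d).
Hypothesis r0 : 0 < r.
Hypothesis hf : similarity r f.

Lemma similarity_inj : injective f.
Proof.
move=> x y fxy; apply/eqP; rewrite -subr_eq0; apply/eqP/enorm_eq0.
have := hf x y; rewrite fxy subrr enorm0 => /esym/eqP.
by rewrite mulf_eq0 gt_eqF//= => /eqP.
Qed.

(** After subtracting [f 0] and dividing by [r], a similarity preserves inner
    products (polarization), hence sends the standard basis to an orthonormal
    family: the matrix [G] of that family is orthogonal and the map is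
    multiplication by [G], which is onto because a one-sided inverse of a square
    matrix is two-sided. *)
Lemma similarity_surj y : exists x, f x = y.
Proof.
pose g x := r^-1 *: (f x - f 0).
have gdist x z : dot (g x - g z) (g x - g z) = dot (x - z) (x - z).
  rewrite -!sqr_enorm; congr (_ ^+ 2).
  have -> : g x - g z = r^-1 *: (f x - f z).
    by rewrite /g -scalerBr opprB addrA subrK.
  have -> : enorm (r^-1 *: (f x - f z)) = r^-1 * enorm (f x - f z).
    rewrite {1}/enorm.
    have -> : \sum_(j < d) (r^-1 *: (f x - f z)) ord0 j ^+ 2 =
       r^-1 ^+ 2 * \sum_(j < d) (f x - f z) ord0 j ^+ 2.
      by rewrite mulr_sumr; apply: eq_bigr => j _; rewrite !mxE exprMn.
    by rewrite sqrtrM ?sqr_ge0// sqrtr_sqr ger0_norm// invr_ge0 ltW.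
  by rewrite hf mulKf// gt_eqF.
have g0 : g 0 = 0 by rewrite /g subrr scaler0.
have gdot x z : dot (g x) (g z) = dot x z.
  have h1 := gdist x z.
  have h2 := gdist x 0; rewrite g0 !subr0 in h2.
  have h3 := gdist z 0; rewrite g0 !subr0 in h3.
  move: h1; rewrite !dotBl !dotBr h2 h3 (dotC (g z)) (dotC z); lra.
pose e (i : 'I_d) : 'rV[R]_d := delta_mx ord0 i.
have dote x i : dot x (e i) = x ord0 i.
  rewrite /dot (bigD1 i)//= !mxE !eqxx/= mulr1 big1 ?addr0// => j ji.
  by rewrite !mxE eqxx/= (negbTE ji) mulr0.
pose G : 'M[R]_d := \matrix_(i, j) g (e i) ord0 j.
have gG x : g x *m G^T = x.
  apply/rowP => i; rewrite !mxE -[RHS]dote -gdot.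
  by apply: eq_bigr => j _; rewrite !mxE.
have GG : G *m G^T = 1%:M.
  apply/matrixP => i k; rewrite !mxE.
  transitivity (dot (g (e i)) (g (e k))).
    by apply: eq_bigr => j _; rewrite !mxE.
  by rewrite gdot dote !mxE eqxx/= eq_sym.
have GG' := mulmx1C GG.
exists ((r^-1 *: (y - f 0)) *m G^T).
have : g ((r^-1 *: (y - f 0)) *m G^T) = r^-1 *: (y - f 0).
  by rewrite -[LHS]mulmx1 -GG' mulmxA gG -mulmxA GG' mulmx1.
rewrite /g => /(congr1 (fun v => r *: v)); rewrite !scalerA divff ?gt_eqF//.
by rewrite !scale1r => /addIr.
Qed.

End Similarity.

(** * Words of similarities and the open set condition *)

(** Points of a ball of radius [C * D] that are [rho * D] apart lie in different
    cells of a grid of mesh comparable to [D], and the number of cells that the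
    ball meets does not depend on [D]. *)
Lemma separated_card_bound (R : realType) (d : nat) (rho C : R) :
  0 < rho -> 0 < C ->
  exists c : nat, forall (D : R) (I : finType) (y : I -> 'rV[R]_d) x0, 0 < D ->
    (forall i, enorm (y i - x0) <= C * D) ->
    (forall i j, i != j -> rho * D <= enorm (y i - y j)) ->
    (#|I| <= c)%N.
Proof.
move=> rho0 C0.
pose k : R := Num.sqrt d%:R + 1.
have k0 : 0 < k by rewrite ltr_wpDl ?sqrtr_ge0.
pose m := Num.truncn (2 * C * k / rho).
exists (#|{ffun 'I_d -> 'I_m.+1}|) => D I y x0 D0 yC ysep.
pose eta := rho * D / k.
have eta0 : 0 < eta by rewrite divr_gt0// mulr_gt0.
pose co i j := ((y i - x0) ord0 j + C * D) / eta.
have co0 i j : 0 <= co i j.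
  rewrite divr_ge0// ?(ltW eta0)//.
  have := le_trans (enorm_coord (y i - x0) j) (yC i); rewrite ler_norml; lra.
have com i j : (Num.truncn (co i j) < m.+1)%N.
  rewrite ltnS; apply: le_truncn; rewrite ler_pdivrMr//.
  have -> : 2 * C * k / rho * eta = 2 * C * D.
    by rewrite /eta; field; rewrite !gt_eqF.
  have := le_trans (enorm_coord (y i - x0) j) (yC i); rewrite ler_norml; lra.
pose cell i := [ffun j => Ordinal (com i j)].
apply: (@leq_card _ _ cell) => i1 i2 /ffunP e; apply/eqP; apply: contraT => ne.
have := ysep _ _ ne; rewrite leNgt => /negP[].
apply: (@le_lt_trans _ _ (Num.sqrt d%:R * eta)).
  apply: enorm_le_sup => [|j]; first exact: ltW.
  have /(congr1 val) /= := e j; rewrite !ffunE/= => ej.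
  have /andP[a1 a2] := truncn_itv (co0 i1 j).
  have /andP[b1 b2] := truncn_itv (co0 i2 j).
  rewrite -ej in b1 b2; rewrite -natr1 in a2 b2.
  have : `|co i1 j - co i2 j| <= 1 by rewrite ler_norml; lra.
  have -> : co i1 j - co i2 j = (y i1 - y i2) ord0 j / eta.
    by rewrite /co !mxE; field; rewrite gt_eqF.
  by rewrite normrM normfV (gtr0_norm eta0) ler_pdivrMr// mul1r.
rewrite /eta mulrA ltr_pdivrMr// [X in _ < X]mulrC ltr_pM2r ?mulr_gt0//.
by rewrite ltrDl.
Qed.

Section Words.
Variables (R : realType) (N : nat) (r : 'I_N -> R).
Hypothesis hr : forall i, 0 < r i < 1.
Implicit Types x y : seq 'I_N.

Definition wratio x : R := \prod_(i <- x) r i.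

Lemma wratio_cat x y : wratio (x ++ y) = wratio x * wratio y.
Proof. exact: big_cat. Qed.

Lemma wratio_rcons x i : wratio (rcons x i) = wratio x * r i.
Proof. by rewrite -cats1 wratio_cat /wratio big_seq1. Qed.

Lemma wratio_gt0 x : 0 < wratio x.
Proof. by apply: prodr_gt0 => i _; case/andP: (hr i). Qed.

Lemma ratio_bounds : exists2 b : R * R, 0 < b.1 <= b.2 & b.2 < 1 /\
  forall i, b.1 <= r i <= b.2.
Proof.
pose a := \big[Num.min/2^-1]_i r i.
pose b := \big[Num.max/2^-1]_i r i.
have a0 : 0 < a.
  rewrite /a; elim/big_ind : _ => [|u v u0 v0|i _]; first by rewrite invr_gt0.
    by rewrite lt_min u0.
  by case/andP: (hr i).
have b1 : b < 1.
  rewrite /b; elim/big_ind : _ => [|u v u0 v0|i _]; first by rewrite invf_lt1 ?ltr1n.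
    by rewrite gt_max u0.
  by case/andP: (hr i).
have ai i : a <= r i by apply: bigmin_le.
have bi i : r i <= b by apply: (le_bigmax _ r).
exists (a, b) => /=; last by split=> // i; rewrite ai bi.
rewrite a0/=; apply: (@le_trans _ _ 2^-1); first exact: bigmin_le_id.
exact: bigmax_ge_id.
Qed.

Lemma wratio_le (b : R) x : (forall i, r i <= b) -> wratio x <= b ^+ size x.
Proof.
move=> rb; elim: x => [|i x IH]; first by rewrite /wratio big_nil expr0.
rewrite /wratio big_cons exprS ler_pM// ?prodr_ge0//; first by case/andP: (hr i) => /ltW.
by move=> j _; case/andP: (hr j) => /ltW.
Qed.

Lemma wratio_ge (a : R) x : 0 <= a -> (forall i, a <= r i) -> a ^+ size x <= wratio x.
Proof.
move=> a0 ra; elim: x => [|i x IH]; first by rewrite /wratio big_nil expr0.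
by rewrite /wratio big_cons exprS ler_pM// exprn_ge0.
Qed.

Lemma wratio_le1 x : wratio x <= 1.
Proof. by rewrite (le_trans (wratio_le _ (b := 1) _)) ?expr1n// => i; case/andP: (hr i) => _ /ltW. Qed.

Variables (d : nat) (f : 'I_N -> 'rV[R]_d -> 'rV[R]_d).
Hypothesis hf : forall i, similarity (r i) (f i).

Lemma foldr_similarity x : similarity (wratio x) (fun z => foldr f z x).
Proof.
move=> z z'; elim: x => [|i x IH] /=; first by rewrite /wratio big_nil mul1r.
by rewrite hf IH mulrA /wratio big_cons.
Qed.

Lemma orbit_bounded : exists2 R0 : R, 0 < R0 & forall x, enorm (foldr f 0 x) <= R0.
Proof.
have [[a b] /= /andP[a0 ab] [b1 hab]] := ratio_bounds.
pose m := \big[Num.max/1]_i enorm (f i 0).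
have m1 : 1 <= m by apply: bigmax_ge_id.
have mi i : enorm (f i 0) <= m by apply: (le_bigmax _ (fun i => enorm (f i 0))).
exists (m / (1 - b)) => [|x]; first by apply: divr_gt0; lra.
have b2 : 0 < 1 - b by lra.
have h0 : 0 <= m / (1 - b) by rewrite divr_ge0 //; lra.
elim: x => [|i x IH] /=; first by rewrite enorm0.
have := enorm_trans (f i (foldr f 0 x)) (f i 0) 0; rewrite hf !subr0 => h.
apply: (le_trans h).
apply: (@le_trans _ _ (b * (m / (1 - b)) + m)).
  apply: lerD => //; apply: ler_pM; rewrite ?enorm_ge0//.
    by case/andP: (hr i) => /ltW.
  by case/andP: (hab i).
by rewrite le_eqVlt; apply/orP; left; apply/eqP; field; rewrite gt_eqF.
Qed.

(** Two prefixes of [om] that share their first [q] letters code points within a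
    multiple of the ratio of these letters, so the prefixes code a Cauchy
    sequence. *)
Lemma coded_point (om : nat -> 'I_N) :
  exists x : 'rV[R]_d, (fun n => foldr f 0 (mkseq om n)) @ \oo --> x.
Proof.
have [[a b] /= /andP[a0 ab] [b1 hab]] := ratio_bounds.
have [R0 R00 hR0] := orbit_bounded.
pose u n : 'rV[R]_d := foldr f 0 (mkseq om n).
have step q n : (q <= n)%N -> enorm (u n - u q) <= b ^+ q * R0.
  move=> qn; rewrite /u.
  have -> : mkseq om n = mkseq om q ++ [seq om i | i <- iota q (n - q)].
    by rewrite /mkseq -map_cat -[in iota q _](add0n q) -iotaD subnKC.
  rewrite foldr_cat (foldr_similarity (mkseq om q)) subr0.
  rewrite ler_pM ?enorm_ge0// ?(ltW (wratio_gt0 _))//.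
  have := @wratio_le b (mkseq om q); rewrite size_mkseq; apply => i.
  by case/andP: (hab i).
apply/cvg_ex; change (cvgn u).
apply: cauchy_cvg; apply: cauchy_exP => e e0.
have : (fun q => b ^+ q * R0) @ \oo --> (0 : R).
  rewrite -[X in _ --> X](mul0r R0); apply: cvgMl; apply: cvg_expr.
  by rewrite ger0_norm//; lra.
move/cvgrPdist_lt => /(_ (e / 2)); rewrite divr_gt0// => /(_ isT) [q _ hq].
have {}hq : b ^+ q * R0 < e / 2.
  have := hq q (leqnn q); rewrite sub0r normrN ger0_norm// mulr_ge0//; last lra.
  by apply: exprn_ge0; lra.
exists (u q), q => // n /= qn; rewrite -ball_normE/= distrC.
apply: le_lt_trans (norm_le_enorm _) _; apply: le_lt_trans (step q n qn) _.
by lra.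
Qed.

Lemma coded_point_near : exists2 R0 : R, 0 < R0 &
  forall (z : 'rV[R]_d) (om : nat -> 'I_N) (x : 'rV[R]_d) q,
    (fun n => foldr f 0 (mkseq om n)) @ \oo --> x ->
    enorm (x - foldr f z (mkseq om q)) <= wratio (mkseq om q) * (R0 + enorm z).
Proof.
have [R0 R00 hR0] := orbit_bounded; exists R0 => // z om x q omx.
apply: (enorm_cvg_le omx); exists q => // n /= qn.
have -> : mkseq om n = mkseq om q ++ [seq om i | i <- iota q (n - q)].
  by rewrite /mkseq -map_cat -[in iota q _](add0n q) -iotaD subnKC.
rewrite foldr_cat (foldr_similarity (mkseq om q)) ler_pM2l ?wratio_gt0//.
by rewrite (le_trans (enormB _ _))// lerD2r.
Qed.

Definition incomparable x y := ~~ prefix x y && ~~ prefix y x.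

(** The images of the open set under incomparable words are disjoint, and each
    contains the ball of radius proportional to the ratio of its word around the
    image of an interior point, because similarities are onto. *)
Lemma incomparable_separated : open_set_condition f ->
  exists z : 'rV[R]_d, exists2 e : R, 0 < e & forall x y, incomparable x y ->
    e * wratio x <= enorm (foldr f z x - foldr f z y).
Proof.
move=> [U [[[z Uz] _ Uo] [fU fdisj _]]].
have stable x u : U u -> U (foldr f u x).
  by move=> Uu; elim: x => //= i x IH; apply: (fU i); exists (foldr f u x).
have finj i : injective (f i) by apply: similarity_inj (hf i); case/andP: (hr i).
have disj x y u v : incomparable x y -> U u -> U v -> foldr f u x <> foldr f v y.
  rewrite /incomparable; elim: x y => [|i x IH] [|j y]//=.
  move=> xy Uu Uv; have [ij|ij] := eqVneq i j.
    by subst j; move=> /finj; apply: IH => //; move: xy; rewrite !eqxx.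
  move=> e; have : (f i @` U `&` f j @` U) (f i (foldr f u x)).
    split; first by exists (foldr f u x) => //; exact: stable.
    by rewrite e; exists (foldr f v y) => //; exact: stable.
  by rewrite fdisj.
have [e /= e0 eU] : exists2 e : R, 0 < e & forall u, enorm (u - z) < e -> U u.
  have /nbhs_ballP[e /= e0 he] := open_nbhs_nbhs (conj Uo Uz).
  exists e => // u ue; apply: he; rewrite -ball_normE/= distrC.
  exact: le_lt_trans (norm_le_enorm _) ue.
exists z, e => // x y xy; rewrite leNgt; apply/negP => lt.
have surj : exists u, foldr f u x = foldr f z y.
  have [u hu] := similarity_surj (wratio_gt0 x) (foldr_similarity x) (foldr f z y).
  by exists u.
case: surj => u hu; apply: (disj x y u z) => //; apply: eU.
move: lt; rewrite -hu (foldr_similarity x) mulrC enormBC.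
by rewrite ltr_pM2r ?wratio_gt0.
Qed.

End Words.

(** * Counting words of a given type *)

Section TypeClass.
Variable N : nat.
Implicit Types (n : 'I_N -> nat) (i : 'I_N) (w : seq 'I_N).

Definition decr n i : 'I_N -> nat := fun k => (n k - (k == i))%N.

(** The words with exactly [n i] occurrences of each letter [i], when the
    entries of [n] add up to [L]. *)
Fixpoint type_class (L : nat) n : seq (seq 'I_N) :=
  if L is L'.+1 then
    [seq i :: w | i <- [seq i <- enum 'I_N | (0 < n i)%N], w <- type_class L' (decr n i)]
  else [:: [::]].

Lemma decr_sum n i : (0 < n i)%N -> (\sum_k n k = (\sum_k decr n i k).+1)%N.
Proof.
move=> ni; rewrite (bigD1 i)//= [in RHS](bigD1 i)//= {1}/decr eqxx subn1.
rewrite -addSn prednK//; congr addn; apply: eq_bigr => k ki.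
by rewrite /decr (negbTE ki) subn0.
Qed.

(** The multinomial coefficient, by recursion on the first letter: a letter [i]
    starts a proportion [n i / L] of the words. *)
Lemma size_type_class L n : (\sum_i n i = L)%N ->
  (size (type_class L n) * \prod_i (n i)`! = L`!)%N.
Proof.
elim: L n => [|L IH] n sn.
  rewrite /= mul1n fact0 big1// => i _.
  have /eqP := sn; rewrite sum_nat_eq0 => /forallP/(_ i)/eqP ->//.
rewrite [type_class _ _]/= size_allpairs_dep sumnE big_map big_filter.
rewrite big_enum_cond big_distrl/=.
transitivity (\sum_(i | 0 < n i) n i * L`!)%N; last first.
  rewrite factS -sn big_distrl/= [in RHS](bigID (fun i => 0 < n i)%N)/=.
  rewrite [X in (_ + X)%N]big1 ?addn0// => i; rewrite lt0n negbK => /eqP ->.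
  by rewrite mul0n.
apply: eq_bigr => i ni.
have si : (\sum_k decr n i k = L)%N by have := decr_sum ni; rewrite sn => -[].
rewrite -(IH _ si) (bigD1 i)//= [in RHS](bigD1 i)//=.
have -> : (\prod_(k | k != i) (decr n i k)`! = \prod_(k | k != i) (n k)`!)%N.
  by apply: eq_bigr => k ki; rewrite /decr (negbTE ki) subn0.
rewrite /decr eqxx subn1; case: (n i) ni => // m _.
by rewrite factS /= [RHS]mulnCA -mulnA.
Qed.

Lemma type_class_uniq L n : uniq (type_class L n).
Proof.
elim: L n => [//|L IH] n /=; apply: allpairs_uniq_dep => [|i _|].
- by rewrite filter_uniq ?enum_uniq.
- exact: IH.
- by move=> [i w] [i' w'] _ _ /= [-> ->].
Qed.

Lemma type_class_size L n w : w \in type_class L n -> size w = L.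
Proof.
elim: L n w => [|L IH] n w /=; first by rewrite inE => /eqP ->.
by move=> /allpairsPdep[i [v [_ /IH <- ->]]].
Qed.

Lemma type_class_prod (R : comRingType) (g : 'I_N -> R) L n w :
  (\sum_i n i = L)%N -> w \in type_class L n ->
  \prod_(i <- w) g i = \prod_i g i ^+ n i.
Proof.
elim: L n w => [|L IH] n w sn /=.
  rewrite inE => /eqP ->; rewrite big_nil big1// => i _.
  by have /eqP := sn; rewrite sum_nat_eq0 => /forallP/(_ i)/eqP ->.
move=> /allpairsPdep[i [v [/[!mem_filter]/andP[ni _] vT ->]]].
have si : (\sum_k decr n i k = L)%N by have := decr_sum ni; rewrite sn => -[].
rewrite big_cons (IH _ _ si vT) (bigD1 i)//= [in RHS](bigD1 i)//= mulrA -exprS.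
rewrite {1}/decr eqxx subn1 prednK//; congr (_ * _); apply: eq_bigr => k ki.
by rewrite /decr (negbTE ki) subn0.
Qed.

End TypeClass.

Section FactorialBounds.
Variable R : realType.
Local Notation e := (expR (1 : R)).

(** Induction with [(1 + 1 / n) ^ n <= e]. *)
Lemma fact_lower n : (n%:R ^+ n : R) <= n`!%:R * e ^+ n.
Proof.
elim: n => [|[|n] IH]; first by rewrite expr0 mulr1.
  by rewrite !expr1 mul1r ltW// expR_gt1.
rewrite factS exprS natrM -mulrA ler_wpM2l// exprS.
have n0 : 0 < n.+1%:R :> R by [].
apply: (@le_trans _ _ (e * (n.+1%:R ^+ n.+1))); last first.
  by rewrite mulrCA ler_wpM2l// expR_ge0.
rewrite -exprS -ler_pdivrMr ?exprn_gt0// -expr_div_n.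
have -> : n.+2%:R / n.+1%:R = 1 + n.+1%:R^-1 :> R.
  by rewrite -natr1 mulrDl divff ?mul1r// gt_eqF.
apply: (@le_trans _ _ (expR (n.+1%:R^-1) ^+ n.+1)).
  by rewrite lerXn2r ?nnegrE ?expR_ge0 ?expR_ge1Dx// addr_ge0.
by rewrite -expRM_natl divff ?gt_eqF.
Qed.

(** Induction with [(1 - 1 / (n + 1)) ^ (n + 1) <= 1 / e]. *)
Lemma fact_upper n : (0 < n)%N -> n`!%:R * e ^+ n <= e * n%:R * n%:R ^+ n :> R.
Proof.
case: n => // n _; elim: n => [|n IH]; first by rewrite !expr1 mul1r !mulr1.
rewrite factS natrM exprS.
apply: (@le_trans _ _ (n.+2%:R * e * (n.+1`!%:R * e ^+ n.+1))).
  by rewrite le_eqVlt; apply/orP; left; apply/eqP; ring.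
apply: (@le_trans _ _ (n.+2%:R * e * (e * n.+1%:R * n.+1%:R ^+ n.+1))).
  by rewrite ler_wpM2l// mulr_ge0// expR_ge0.
have n0 : 0 < n.+2%:R :> R by [].
suff h : e * n.+1%:R ^+ n.+2 <= n.+2%:R ^+ n.+2.
  have -> : n.+2%:R * e * (e * n.+1%:R * n.+1%:R ^+ n.+1) =
     n.+2%:R * e * (e * n.+1%:R ^+ n.+2) :> R by rewrite [n.+1%:R ^+ n.+2]exprS !mulrA.
  have -> : e * n.+2%:R * (n.+2%:R * n.+2%:R ^+ n.+1) =
     n.+2%:R * e * n.+2%:R ^+ n.+2 :> R by rewrite -exprS (mulrC e).
  by rewrite ler_wpM2l// mulr_ge0// expR_ge0.
suff : (n.+1%:R / n.+2%:R) ^+ n.+2 <= e^-1.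
  rewrite expr_div_n ler_pdivrMr ?exprn_gt0// => h.
  by rewrite -ler_pdivlMl ?expR_gt0.
have -> : n.+1%:R / n.+2%:R = 1 + (- n.+2%:R^-1) :> R.
  apply: (mulIf (lt0r_neq0 n0)); rewrite divfK ?gt_eqF// mulrDl mul1r mulNr.
  by rewrite mulVf ?gt_eqF// -[n.+2]addn1 natrD addrK.
apply: (@le_trans _ _ (expR (- n.+2%:R^-1) ^+ n.+2)).
  rewrite lerXn2r ?nnegrE ?expR_ge0 ?expR_ge1Dx// subr_ge0 invf_le1// ler1n//.
by rewrite -expRM_natl mulrN mulfV ?gt_eqF// expRN.
Qed.

End FactorialBounds.

Section LargeTypeClass.
Variables (R : realType) (N : nat) (q : 'I_N -> R).
Hypotheses (q0 : forall i, 0 < q i) (q1 : \sum_i q i = 1).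

Let n (k : nat) (i : 'I_N) := Num.truncn (q i * k%:R).
Let L k := (\sum_i n k i)%N.
Local Notation e := (expR (1 : R)).

Let nq k i : (n k i)%:R <= q i * k%:R.
Proof. by rewrite truncn_le// mulr_ge0// ltW. Qed.

Let kq k : k%:R = \sum_i q i * k%:R.
Proof. by rewrite -mulr_suml q1 mul1r. Qed.

Let L_le k : (L k)%:R <= k%:R :> R.
Proof.
rewrite [leRHS]kq /L natr_sum; apply: ler_sum => i _; exact: nq.
Qed.

Let L_ge k : k%:R - N%:R <= (L k)%:R :> R.
Proof.
rewrite lerBlDr [leLHS]kq /L natr_sum.
have -> : N%:R = \sum_(i < N) (1 : R) by rewrite sumr_const card_ord.
rewrite -big_split/=; apply: ler_sum => i _.
by rewrite natr1 ltW// truncnS_gt.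
Qed.

(** By Stirling, a type class of near-optimal type carries all but a polynomial
    fraction of the mass of the product measure of [q]. *)
Lemma type_class_mass k : (0 < k)%N -> (2 * N <= k)%N ->
  (expR 3 * k%:R) ^- N <=
  (size (type_class (L k) (n k)))%:R * \prod_i q i ^+ n k i.
Proof.
move=> k0 kN; set B := size _.
have kR : 0 < k%:R :> R by rewrite ltr0n.
have e0 : 0 < e by exact: expR_gt0.
have fi i : ((n k i)`!)%:R <= e * k%:R * (q i * k%:R / e) ^+ n k i.
  case: (posnP (n k i)) => [->|ni].
    rewrite fact0 expr0 mulr1.
    have k1 : 1 <= k%:R :> R by rewrite ler1n.
    by rewrite -[leLHS]mulr1 ler_pM// ltW// expR_gt1.
  rewrite expr_div_n mulrA ler_pdivlMr ?exprn_gt0//.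
  apply: le_trans (fact_upper R ni) _.
  have nk : (n k i)%:R <= k%:R :> R.
    apply: le_trans (nq k i) _; rewrite [leRHS]kq (bigD1 i)//= lerDl.
    by apply: sumr_ge0 => j _; rewrite mulr_ge0// ltW.
  rewrite ler_pM ?mulr_ge0 ?exprn_ge0 ?(ltW e0)// ?ler_wpM2l ?(ltW e0)//.
  by rewrite lerXn2r ?nnegrE ?nq// mulr_ge0// ltW.
have fprod : \prod_i ((n k i)`!)%:R <=
    (e * k%:R) ^+ N * ((\prod_i q i ^+ n k i) * (k%:R / e) ^+ L k).
  apply: (@le_trans _ _ (\prod_i (e * k%:R * (q i * k%:R / e) ^+ n k i))).
    by apply: ler_prod => i _; rewrite ler0n; exact: fi.
  rewrite big_split/= prodr_const card_ord ler_wpM2l ?exprn_ge0 ?mulr_ge0 ?(ltW e0)//.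
  rewrite -prodrXr -big_split/= le_eqVlt; apply/orP; left; apply/eqP.
  by apply: eq_bigr => i _; rewrite -exprMn mulrA.
have fact : ((L k)%:R / e) ^+ L k <= B%:R * \prod_i ((n k i)`!)%:R :> R.
  rewrite -natr_prod -natrM size_type_class// expr_div_n ler_pdivrMr ?exprn_gt0//.
  exact: fact_lower.
set Q := \prod_i q i ^+ n k i in fprod *.
have main : ((L k)%:R / k%:R) ^+ L k <= B%:R * Q * (e * k%:R) ^+ N.
  have ke : 0 < (k%:R / e) ^+ L k by rewrite exprn_gt0// divr_gt0.
  rewrite -(ler_pM2r ke) -exprMn.
  have -> : (L k)%:R / k%:R * (k%:R / e) = (L k)%:R / e.
    by field; rewrite !gt_eqF.
  apply: le_trans fact _.
  have -> : B%:R * Q * (e * k%:R) ^+ N * (k%:R / e) ^+ L k =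
    B%:R * ((e * k%:R) ^+ N * (Q * (k%:R / e) ^+ L k)) by ring.
  by rewrite ler_wpM2l.
have e2 : expR (- (2 * N%:R)) <= ((L k)%:R / k%:R) ^+ L k :> R.
  (* 1 - x >= exp(-2x) on [0, 1/2], applied with x = N / k. *)
  have kN' : 2 * N%:R <= k%:R :> R by rewrite -natrM ler_nat.
  pose x : R := N%:R / k%:R.
  have x0 : 0 <= x by rewrite divr_ge0.
  have x2 : x <= 2^-1.
    by rewrite ler_pdivrMr//; lra.
  have ex : expR (- (2 * x)) <= 1 - x.
    rewrite expRN -[leLHS]mul1r ler_pdivrMr ?expR_gt0//.
    apply: (@le_trans _ _ ((1 - x) * (1 + 2 * x))); last first.
      by rewrite ler_wpM2l ?expR_ge1Dx//; lra.
    by nra.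
  apply: (@le_trans _ _ (expR (- (2 * x)) ^+ k)).
    rewrite -expRM_natl le_eqVlt; apply/orP; left; apply/eqP; congr expR.
    by rewrite /x; field; rewrite gt_eqF.
  have Lk : (L k <= k)%N by have := L_le k; rewrite ler_nat.
  have e1 : expR (- (2 * x)) <= 1 by rewrite expR_le1 oppr_le0; lra.
  apply: (@le_trans _ _ (expR (- (2 * x)) ^+ L k)).
    by rewrite ler_wiXn2l ?expR_ge0.
  rewrite lerXn2r ?nnegrE ?expR_ge0 ?divr_ge0//.
  apply: le_trans ex _; rewrite ler_pdivlMr// mulrBl mul1r /x divfK ?gt_eqF// L_ge.
have ek : 0 < (e * k%:R) ^+ N by rewrite exprn_gt0// mulr_gt0.
have -> : (expR 3 * k%:R) ^- N = expR (- (2 * N%:R)) / (e * k%:R) ^+ N.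
  have -> : expR 3 = expR 2 * e :> R by rewrite -expRD; congr expR; lra.
  rewrite -mulrA exprMn invfM expRN -expRM_natl; congr (_ / _).
  by rewrite mulrC.
by rewrite ler_pdivrMr//; exact: le_trans main.
Qed.

(** Exponential growth of the weights [x] relative to [q], with rate the relative
    entropy, beats the polynomial loss. *)
Lemma type_class_weight (x : 'I_N -> R) : (forall i, 0 < x i) ->
  0 < \sum_i q i * ln (x i / q i) ->
  exists2 c : R, 0 < c & forall k, (0 < k)%N -> (2 * N <= k)%N ->
    c * k%:R <= (size (type_class (L k) (n k)))%:R * \prod_i x i ^+ n k i.
Proof.
move=> x0; set h := \sum_i _ => h0.
pose l i := ln (x i / q i).
pose C := \sum_i `|l i|.
exists (expR (- C) * (h / N.+1%:R) ^+ N.+1 * expR 3 ^- N).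
  by rewrite !mulr_gt0 ?expR_gt0 ?exprn_gt0 ?divr_gt0 ?invr_gt0 ?exprn_gt0 ?expR_gt0.
move=> k k0 kN.
have kR : 0 < k%:R :> R by rewrite ltr0n.
have xq i : x i = q i * expR (l i).
  by rewrite /l lnK ?posrE ?divr_gt0// mulrC divfK// gt_eqF.
have -> : \prod_i x i ^+ n k i =
    (\prod_i q i ^+ n k i) * expR (\sum_i (n k i)%:R * l i).
  rewrite expR_sum -big_split/=; apply: eq_bigr => i _.
  by rewrite xq exprMn expRM_natl.
have h1 : k%:R * h - C <= \sum_i (n k i)%:R * l i.
  rewrite mulr_sumr -sumrB; apply: ler_sum => i _.
  have a := nq k i.
  have b : q i * k%:R < (n k i)%:R + 1 by rewrite natr1 truncnS_gt.
  rewrite -/(l i) mulrCA mulrA lerBlDr -lerBlDl -mulrBl (le_trans (ler_norm _))//.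
  rewrite normrM ler_piMl// ger0_norm; lra.
have h2 : (k%:R * h / N.+1%:R) ^+ N.+1 <= expR (k%:R * h).
  apply: (@le_trans _ _ (expR (k%:R * h / N.+1%:R) ^+ N.+1)); last first.
    by rewrite -expRM_natl mulrCA divff ?mulr1.
  rewrite lerXn2r ?nnegrE ?expR_ge0//.
    by rewrite divr_ge0// mulr_ge0// ltW.
  by rewrite (le_trans _ (expR_ge1Dx _))// lerDr.
have m := type_class_mass k0 kN.
rewrite mulrA.
apply: (@le_trans _ _ ((expR 3 * k%:R) ^- N *
   (expR (- C) * (k%:R * h / N.+1%:R) ^+ N.+1))); last first.
  apply: ler_pM => //.
    by rewrite mulr_ge0 ?expR_ge0// exprn_ge0// divr_ge0// mulr_ge0// ltW.
  apply: (@le_trans _ _ (expR (- C) * expR (k%:R * h))).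
    by rewrite ler_wpM2l ?expR_ge0.
  by rewrite -expRD ler_expR addrC.
rewrite le_eqVlt; apply/orP; left; apply/eqP.
have -> : k%:R * h / N.+1%:R = k%:R * (h / N.+1%:R) by rewrite mulrA.
rewrite (exprMn _ k%:R) (exprMn _ (expR 3)) invfM (exprS k%:R).
have kN0 : k%:R ^+ N != 0 :> R by rewrite gt_eqF// exprn_gt0.
set a := (h / _) ^+ _; set b := _ ^- N; set u := expR (- C); set v := _ ^+ N in kN0 *.
by field.
Qed.

End LargeTypeClass.

Lemma powR_expr (R : realType) (a s : R) k : 0 <= a -> (a `^ s) ^+ k = (a ^+ k) `^ s.
Proof.
move=> a0; rewrite -[LHS]powR_mulrn ?powR_ge0// -(powR_mulrn k a0).
by rewrite -!powRrM mulrC.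
Qed.

Lemma prodr_powR (R : realType) (I : Type) (s : seq I) (P : pred I) (F : I -> R) (a : R) :
  (forall i, 0 <= F i) -> \prod_(i <- s | P i) F i `^ a = (\prod_(i <- s | P i) F i) `^ a.
Proof.
move=> F0; elim: s => [|i s IH]; first by rewrite !big_nil powR1.
rewrite !big_cons; case: (P i) => //.
by rewrite IH powRM// prodr_ge0.
Qed.

(** Disjoint groups of words of one length and one ratio, each of which is seen by
    at least two descendants on average, while the number of groups still has
    exponent larger than [s].  The words are those of a type class near [q], with
    [B] members and mean multiplicity [mu] each, and a group has about
    [2 * max 1 (1 / mu)] of them: so there are about [B * min 1 mu] groups, and
    the two hypotheses on [q] make both [B] and [B * mu] larger than [rho^-s]. *)
Lemma colour_family (R : realType) (N M : nat) (p r q : 'I_N -> R) (s : R) :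
  (0 < M)%N -> (forall i, 0 < p i) -> (forall i, 0 < r i < 1) ->
  (forall i, 0 < q i) -> \sum_i q i = 1 -> 0 < s ->
  0 < \sum_i q i * ln (r i `^ s / q i) ->
  0 < \sum_i q i * ln (r i `^ s * (M%:R * p i) / q i) ->
  exists L B : nat, exists rho : R, exists col : 'I_B -> seq (seq 'I_N),
  [/\ forall c w, w \in col c -> size w = L /\ wratio r w = rho,
      forall c, uniq (col c),
      forall c c' w, w \in col c -> w \in col c' -> c = c',
      forall c, 2 <= M%:R ^+ L * \sum_(w <- col c) wratio p w
    & 0 < rho /\ 1 < B%:R * rho `^ s].
Proof.
move=> M0 p0 hr q0 q1 s0 h1 h2.
have r0 i : 0 < r i by case/andP: (hr i).
have MR : 0 < M%:R :> R by rewrite ltr0n.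
have [c1 c10 H1] := type_class_weight q0 q1 (fun i => powR_gt0 s (r0 i)) h1.
have [i|c2 c20 H2] := type_class_weight q0 q1 _ h2.
  by rewrite mulr_gt0 ?powR_gt0// mulr_gt0.
(* The target 6 = 2 * 3 leaves a factor 3 for rounding up the size of the groups
   and a factor 2 for rounding down their number. *)
pose k := (Num.truncn (7 / c1) + Num.truncn (7 / c2) + 2 * N).+1.
have [k1 k2 k3] : [/\ (0 < k)%N, (2 * N <= k)%N & 6 < c1 * k%:R /\ 6 < c2 * k%:R].
  have aux (c : R) (m : nat) : 0 < c -> (Num.truncn (7 / c) < m)%N -> 6 < c * m%:R.
    move=> c0 cm; rewrite mulrC -ltr_pdivrMr//.
    apply: (@lt_le_trans _ _ (7 / c)); first by rewrite ltr_pM2r ?invr_gt0// ltr_nat.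
    have := truncnS_gt (7 / c); move/ltW/le_trans; apply.
    by rewrite ler_nat.
  split; rewrite ?/k//; first by rewrite leqW// leq_addl.
  by split; apply: aux => //; rewrite ltnS -addnA ?leq_addr// addnCA leq_addr.
have {k3}[k3 k4] := k3.
pose n (i : 'I_N) := Num.truncn (q i * k%:R).
pose L := (\sum_i n i)%N.
pose T := type_class L n.
pose rho := \prod_i r i ^+ n i.
pose mu := M%:R ^+ L * \prod_i p i ^+ n i.
have rho0 : 0 < rho by apply: prodr_gt0 => i _; rewrite exprn_gt0.
have mu0 : 0 < mu by rewrite mulr_gt0 ?exprn_gt0//; apply: prodr_gt0 => i _; rewrite exprn_gt0.
have rhoT w : w \in T -> wratio r w = rho by move=> wT; apply: type_class_prod wT.
have pT w : w \in T -> wratio p w = \prod_i p i ^+ n i.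
  by move=> wT; apply: type_class_prod wT.
have rhos : \prod_i (r i `^ s) ^+ n i = rho `^ s.
  rewrite -prodr_powR => [|i]; last by rewrite exprn_ge0// ltW.
  apply: eq_bigr => i _; exact/powR_expr/ltW.
have {}H1 : 6 < (size T)%:R * rho `^ s.
  by rewrite -rhos; apply: lt_le_trans k3 _; apply: H1.
have {}H2 : 6 < (size T)%:R * mu * rho `^ s.
  apply: lt_le_trans k4 (le_trans (H2 _ k1 k2) _).
  rewrite -/n -/L -/T; under eq_bigr do rewrite exprMn exprMn.
  rewrite !big_split/= rhos prodrXr -/L -/mu.
  by rewrite le_eqVlt; apply/orP; left; apply/eqP; ring.
have rhos0 : 0 < rho `^ s by apply: powR_gt0.
have rhos1 : rho `^ s <= 1.
  rewrite -(powRr0 rho); apply: ger_powR; last exact: ltW.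
  rewrite rho0/= prodr_ile1// => i _.
  by case/andP: (hr i) => a b; rewrite exprn_ge0 ?exprn_ile1// ltW.
pose m : R := Num.max 1 mu^-1.
have m1 : 1 <= m by rewrite le_max lexx.
have m2 : 1 <= m * mu by rewrite -ler_pdivrMr// mul1r le_max lexx orbT.
pose kap := (Num.truncn (2 * m)).+1.
have kap1 : 2 * m < kap%:R by exact: truncnS_gt.
have kap2 : kap%:R <= 3 * m.
  have : (Num.truncn (2 * m))%:R <= 2 * m by rewrite truncn_le; lra.
  have -> : kap%:R = (Num.truncn (2 * m))%:R + 1 :> R by rewrite natr1.
  lra.
have kap0 : (0 < kap)%N by [].
have Hm : 6 * m < (size T)%:R * rho `^ s.
  rewrite /m; case: (leP 1 mu^-1) => _; last by rewrite mulr1.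
  by rewrite -ltr_pdivlMr ?invr_gt0// invrK mulrAC.
pose B := (size T %/ kap)%N.
exists L, B, rho, (fun c => take kap (drop (c * kap) T)).
have Bk (c : 'I_B) : (c * kap + kap <= size T)%N.
  by rewrite -mulSnr (leq_trans _ (leq_trunc_div (size T) kap))// leq_mul2r ltn_ord orbT.
have inT (c : 'I_B) w : w \in take kap (drop (c * kap) T) -> w \in T.
  by move=> /mem_take/mem_drop.
split.
- by move=> c w /inT wT; rewrite rhoT// (type_class_size wT).
- by move=> c; rewrite take_uniq// drop_uniq// type_class_uniq.
- move=> c c' w.
  have idx (b : 'I_B) : w \in take kap (drop (b * kap) T) -> (index w T %/ kap = b)%N.
    move=> wb.
    have sz : size (take (b * kap) T) = (b * kap)%N.
      by rewrite size_takel// (leq_trans _ (Bk b))// leq_addr.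
    have : uniq T by exact: type_class_uniq.
    rewrite -{1 2}(cat_take_drop (b * kap) T) cat_uniq index_cat => /and3P[_ /hasPn nh _].
    have wd := mem_take wb; have /= wt := nh _ wd; rewrite (negbTE wt) sz.
    rewrite divnMDl//; have lt : (index w (drop (b * kap) T) < kap)%N.
      rewrite -(cat_take_drop kap (drop (b * kap) T)) index_cat wb.
      by rewrite (leq_trans (_ : _ < size (take kap (drop (b * kap) T))))%N ?index_mem// size_take_min geq_minl.
    by rewrite divn_small ?addn0.
  by move=> /idx e /idx e'; apply: val_inj; rewrite /= -e -e'.
- move=> c; rewrite (eq_big_seq (fun=> \prod_i p i ^+ n i)) => [|w /inT/pT//].
  rewrite big_const_seq count_predT iter_addr_0 size_takel; last first.
    by rewrite size_drop leq_subRL ?Bk// (leq_trans _ (Bk c))// leq_addr.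
  rewrite -[X in _ * X]mulr_natr mulrA -/mu.
  apply: (@le_trans _ _ (mu * (2 * m))); last by rewrite ler_pM2l// ltW.
  rewrite mulrCA -[leLHS]mulr1 ler_wpM2l// mulrC; lra.
split=> //.
have kR : 0 < kap%:R :> R by rewrite ltr0n.
have sB : (size T)%:R < (B%:R + 1) * kap%:R :> R.
  by rewrite natr1 -natrM ltr_nat -ltn_divLR.
have : 6 * m < (B%:R + 1) * kap%:R * rho `^ s.
  by apply: lt_trans Hm _; rewrite ltr_pM2r.
have : (B%:R + 1) * kap%:R * rho `^ s <= (B%:R + 1) * (3 * m) * rho `^ s.
  by rewrite ler_wpM2r ?(ltW rhos0)// ler_wpM2l// addr_ge0.
move=> a b; have {a b} := lt_le_trans b a.
have -> : (B%:R + 1) * (3 * m) * rho `^ s = m * (3 * ((B%:R + 1) * rho `^ s)) by ring.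
rewrite mulrC ltr_pM2l; last lra.
rewrite mulrDl mul1r; lra.
Qed.

(** * Independent labels on the tree *)

Section Labellings.
Variables (N M : nat).
Definition labelling := edge M -> 'I_N.
Implicit Types (w : labelling) (u v : seq 'I_M) (S : seq (edge M)).

(** Restriction to the subtree at [u], reindexed so that [u] becomes its root. *)
Definition shift u w : labelling := fun e => w (u ++ e.1, e.2).

Definition shift_edge u (e : edge M) : edge M := (u ++ e.1, e.2).

Fixpoint lab w u : seq 'I_N :=
  if u is a :: u' then w ([::], a) :: lab (shift [:: a] w) u' else [::].

Definition upd w (e : edge M) (i : 'I_N) : labelling :=
  fun e' => if e' == e then i else w e'.

Lemma shift_nil w : shift [::] w = w.
Proof. by apply/funext => -[]. Qed.

Lemma shift_cat u v w : shift (u ++ v) w = shift v (shift u w).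
Proof. by apply/funext => -[x a]; rewrite /shift/= catA. Qed.

Lemma size_lab w u : size (lab w u) = size u.
Proof. by elim: u w => //= a u IH w; rewrite IH. Qed.

Lemma lab_cat w u v : lab w (u ++ v) = lab w u ++ lab (shift u w) v.
Proof.
elim: u w => [|a u IH] w /=; first by rewrite shift_nil.
by rewrite IH -shift_cat.
Qed.

Definition depends (A : Type) S (phi : labelling -> A) :=
  forall w w', {in S, w =1 w'} -> phi w = phi w'.

Lemma depends_sub (A : Type) S S' (phi : labelling -> A) :
  {subset S <= S'} -> depends S phi -> depends S' phi.
Proof. by move=> sub dS w w' e; apply: dS => x /sub/e. Qed.

Lemma depends_comp (A B : Type) S (phi : labelling -> A) (g : A -> B) :
  depends S phi -> depends S (g \o phi).
Proof. by move=> d w w' e /=; rewrite (d _ _ e). Qed.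

Lemma depends_comp2 (A B C : Type) S (phi : labelling -> A) (psi : labelling -> B)
    (g : A -> B -> C) :
  depends S phi -> depends S psi -> depends S (fun w => g (phi w) (psi w)).
Proof. by move=> d d' w w' e /=; rewrite (d _ _ e) (d' _ _ e). Qed.

Lemma depends_shift (A : Type) S u (phi : labelling -> A) :
  depends S phi -> depends (map (shift_edge u) S) (phi \o shift u).
Proof.
move=> d w w' e; apply: d => x xS; rewrite /shift -/(shift_edge u x).
by apply: e; apply: map_f.
Qed.

(** All events of the probabilistic argument are of this kind, up to countable
    limits: they are measurable and their probabilities are finite sums. *)
Definition finite_event (E : labelling -> bool) := exists S, depends S E.

Lemma finite_event_common (I : finType) (E : I -> labelling -> bool) :
  (forall i, finite_event (E i)) -> exists S, forall i, depends S (E i).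
Proof.
move=> /choice[S hS]; exists (flatten [seq S i | i <- enum I]) => i.
apply: depends_sub (hS i) => x xS; apply/flattenP; exists (S i) => //.
by apply: map_f; rewrite mem_enum.
Qed.

Lemma finite_event_forall (I : finType) (E : I -> labelling -> bool) :
  (forall i, finite_event (E i)) -> finite_event (fun w => [forall i, E i w]).
Proof.
move=> /finite_event_common[S hS]; exists S => w w' e.
by apply: eq_forallb => i; apply: hS.
Qed.

Lemma finite_event_exists (I : finType) (E : I -> labelling -> bool) :
  (forall i, finite_event (E i)) -> finite_event (fun w => [exists i, E i w]).
Proof.
move=> /finite_event_common[S hS]; exists S => w w' e.
by apply: eq_existsb => i; apply: hS.
Qed.

Lemma finite_event_and (E E' : labelling -> bool) :
  finite_event E -> finite_event E' -> finite_event (fun w => E w && E' w).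
Proof.
move=> [S hS] [S' hS']; exists (S ++ S'); apply: depends_comp2.
  by apply: depends_sub hS => x; rewrite mem_cat => ->.
by apply: depends_sub hS' => x; rewrite mem_cat orbC => ->.
Qed.

Lemma finite_event_not (E : labelling -> bool) :
  finite_event E -> finite_event (fun w => ~~ E w).
Proof. by move=> [S hS]; exists S; apply: depends_comp. Qed.

Lemma finite_event_shift u (E : labelling -> bool) :
  finite_event E -> finite_event (E \o shift u).
Proof. by move=> [S hS]; eexists; apply: depends_shift; exact: hS. Qed.

Lemma depends_lab u : exists2 S,
  depends S (lab^~ u) & {in S, forall e, (size e.1 < size u)%N}.
Proof.
elim: u => [|a u [S dS sS]] /=; first by exists [::].
exists (([::], a) :: map (shift_edge [:: a]) S) => [w w' e|x].
  rewrite e ?mem_head//; congr cons; apply: (depends_shift dS) => x xS.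
  by apply: e; rewrite inE xS orbT.
rewrite inE => /predU1P[-> //|/mapP[y yS ->]] /=.
by rewrite ltnS; exact: sS.
Qed.

Lemma finite_event_lab u (Q : seq 'I_N -> bool) : finite_event (fun w => Q (lab w u)).
Proof. by have [S dS _] := depends_lab u; exists S; apply: depends_comp dS. Qed.

End Labellings.

Section Expectation.
Variables (R : realType) (N M : nat) (p : 'I_N -> R).
Hypothesis p1 : \sum_i p i = 1.
Local Notation labelling := (labelling N M).
Implicit Types (w : labelling) (S : seq (edge M)) (phi psi : labelling -> R).

(** The conditional expectation given the labels outside [S], at a labelling that
    agrees with [w] there.  Fubini and independence become inductions on [S]. *)
Fixpoint Ex S phi w : R :=
  if S is e :: S' then \sum_i p i * Ex S' phi (upd w e i) else phi w.

Lemma Ex_cat S S' phi w : Ex (S ++ S') phi w = Ex S (Ex S' phi) w.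
Proof. by elim: S w => //= e S IH w; apply: eq_bigr => i _; rewrite IH. Qed.

Lemma Ex_sum (I : Type) (s : seq I) S (phi : I -> labelling -> R) w :
  Ex S (fun w => \sum_(i <- s) phi i w) w = \sum_(i <- s) Ex S (phi i) w.
Proof.
elim: S w => //= e S IH w; rewrite exchange_big/=; apply: eq_bigr => i _.
by rewrite IH mulr_sumr.
Qed.

Lemma ExZ S c phi w : Ex S (fun w => c * phi w) w = c * Ex S phi w.
Proof.
elim: S w => //= e S IH w; rewrite mulr_sumr; apply: eq_bigr => i _.
by rewrite IH mulrCA.
Qed.

Lemma ExB S phi psi w : Ex S (fun w => phi w - psi w) w = Ex S phi w - Ex S psi w.
Proof.
elim: S w => //= e S IH w; rewrite -sumrB; apply: eq_bigr => i _.
by rewrite IH mulrBr.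
Qed.

Lemma Ex_cst S c w : Ex S (fun=> c) w = c.
Proof.
elim: S w => //= e S IH w; under eq_bigr do rewrite IH.
by rewrite -mulr_suml p1 mul1r.
Qed.

Lemma Ex_le S phi psi w : (forall i, 0 <= p i) -> (forall w, phi w <= psi w) ->
  Ex S phi w <= Ex S psi w.
Proof.
move=> p0 le; elim: S w => //= e S IH w; apply: ler_sum => i _.
by rewrite ler_wpM2l.
Qed.

(** A factor that depends on no label of [S] is a constant for the average. *)
Lemma Ex_mul S S' phi psi w : depends S' phi -> {in S', forall e, e \notin S} ->
  Ex S (fun w => phi w * psi w) w = phi w * Ex S psi w.
Proof.
move=> dphi; elim: S w => //= e S IH w disj; rewrite mulr_sumr; apply: eq_bigr => i _.
rewrite IH => [|x /disj]; last by rewrite inE negb_or => /andP[].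
rewrite mulrCA; congr (_ * (_ * _)); apply: dphi => x /disj.
by rewrite inE negb_or /upd => /andP[/negbTE ->].
Qed.

Lemma Ex_shift S u phi w :
  Ex (map (shift_edge u) S) (phi \o shift u) w = Ex S phi (shift u w).
Proof.
elim: S w => //= e S IH w; apply: eq_bigr => i _; rewrite IH; congr (_ * Ex _ _ _).
apply/funext => x; rewrite /shift /upd/= -/(shift_edge u x) -/(shift_edge u e).
case: (eqVneq x e) => [->|xe]; first by rewrite eqxx.
case: eqP => // -[] /eqP; rewrite eqseq_cat// eqxx/= => /eqP e1 e2.
by move: xe; case: x e e1 e2 => [x a] [y b] /= -> ->; rewrite eqxx.
Qed.

Variables (disp : measure_display) (T : measurableType disp) (Pr : probability T R).
Variable omega : edge M -> T -> 'I_N.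
Hypothesis homega : iid_labels Pr p omega.
Hypothesis p0 : forall i, 0 < p i.
Variable w0 : labelling.

Definition labels (t : T) : labelling := fun e => omega e t.

Definition event (E : labelling -> bool) : set T := [set t | E (labels t)].

Let mix S w w' : labelling := fun e => if e \in S then w' e else w e.

Let omegam e i : measurable (omega e @^-1` [set i]).
Proof. by case: homega. Qed.

Let eventS e S E w : e \notin S ->
  event (fun w' => E (mix (e :: S) w w')) =
  \big[setU/set0]_(i < N) (omega e @^-1` [set i] `&`
     event (fun w' => E (mix S (upd w e i) w'))).
Proof.
move=> eS.
have mixE t : mix (e :: S) w (labels t) = mix S (upd w e (omega e t)) (labels t).
  apply/funext => x; rewrite /mix inE /upd; case: eqP => [->|_] //=.
  by rewrite (negbTE eS).
rewrite -bigcup_seq; apply/seteqP; split => [t|t].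
  rewrite /event/= mixE => Et; exists (omega e t) => //=.
  exact: mem_index_enum.
by move=> [i _ [/= ti]]; rewrite /event/= mixE ti.
Qed.

(** Revealing the labels of [S] one at a time: conditionally on finitely many
    other labels, the remaining probability is still the iterated average. *)
Let event_mix S s (b : edge M -> 'I_N) E w : uniq S -> uniq s ->
  {in s, forall e, e \notin S} ->
  measurable (event (fun w' => E (mix S w w'))) /\
  Pr (\bigcap_(e in [set` s]) (omega e @^-1` [set b e]) `&`
      event (fun w' => E (mix S w w'))) =
  ((\prod_(e <- s) p (b e)) * Ex S (fun w => (E w)%:R) w)%:E.
Proof.
elim: S s b w => [|e S IH] s b w uS us disj.
  have -> : event (fun w' => E (mix [::] w w')) = if E w then setT else set0.
    by apply/seteqP; split => t; rewrite /event/=; case: (E w).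
  have PrA : Pr (\bigcap_(e in [set` s]) (omega e @^-1` [set b e])) =
      (\prod_(e <- s) p (b e))%:E.
    have [_ /(_ s (fun e => [set b e]) us) -> hp] := homega.
    by rewrite -prodEFin; apply: eq_bigr => e _; rewrite hp.
  rewrite [Ex _ _ _]/=; case: (E w); first by split=> //; rewrite setIT mulr1n mulr1.
  by split=> //; rewrite setI0 measure0 mulr0n mulr0.
case/andP: uS => eS uS.
have es : e \notin s by apply/negP => /disj; rewrite inE eqxx.
have disj' : {in e :: s, forall x, x \notin S}.
  by move=> x; rewrite inE => /predU1P[->//|/disj]; rewrite inE negb_or => /andP[].
pose bi i : edge M -> 'I_N := fun x => if x == e then i else b x.
have ues : uniq (e :: s) by rewrite /= es.
have {}IH i := IH (e :: s) (bi i) (upd w e i) uS ues disj'.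
rewrite eventS//; split.
  apply: bigsetU_measurable => i _; apply: measurableI => //.
  by case: (IH i).
rewrite -bigcup_seq setI_bigcupr bigcup_seq measure_bigsetU_ord.
- transitivity (\sum_(i < N)
     ((\prod_(e <- s) p (b e)) * (p i * Ex S (fun w => (E w)%:R) (upd w e i)))%:E)%E.
    apply: eq_bigr => i _; case: (IH i) => _.
    have -> : [set` (e :: s)] = e |` [set` s].
      apply/seteqP; split => x /=; rewrite inE.
        by move=> /predU1P[->|]; [left|right].
      by move=> [->|->]; rewrite ?eqxx ?orbT.
    have be : bi i e = i by rewrite /bi eqxx.
    rewrite bigcap_setU1 big_cons be.
    have bE x : x \in s -> bi i x = b x.
      by move=> xs; rewrite /bi; case: eqP => // xe; rewrite -xe xs in es.
    have -> : \bigcap_(x in [set` s]) (omega x @^-1` [set bi i x]) =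
        \bigcap_(x in [set` s]) (omega x @^-1` [set b x]).
      by apply: eq_bigcapr => x xs; rewrite bE.
    rewrite (eq_big_seq (fun x => p (b x))) => [|x /bE -> //].
    by rewrite setIA [X in X `&` _]setIC mulrCA mulrA => <-.
  by rewrite sumEFin -mulr_sumr.
- move=> i; apply: measurableI.
    by apply: fin_bigcap_measurable => // x _; exact: omegam.
  by apply: measurableI => //; case: (IH i).
- by apply/trivIsetP => i j _ _ ij; apply/seteqP; split => // t [] [_ [/= ti _]] [_ [/= tj _]]; rewrite -ti tj eqxx in ij.
Qed.

Lemma event_Ex S E w : depends S E ->
  measurable (event E) /\
  Pr (event E) = (Ex (undup S) (fun w => (E w)%:R) w)%:E.
Proof.
move=> dE.
have [//|mE PE] := @event_mix (undup S) [::] w E w (undup_uniq _) isT.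
have mixE : (fun w' => E (mix (undup S) w w')) = E.
  by apply/funext => w'; apply: dE => e eS; rewrite /mix mem_undup eS.
rewrite mixE in mE PE; split=> //.
by move: PE; rewrite set_nil bigcap_set0 setTI big_nil mul1r.
Qed.

Lemma measurable_event E : finite_event E -> measurable (event E).
Proof. by move=> [S dS]; case: (event_Ex w0 dS). Qed.

Definition prob E : R := fine (Pr (event E)).

Lemma probE E : finite_event E -> Pr (event E) = (prob E)%:E.
Proof. by move=> [S dS]; rewrite /prob; case: (event_Ex w0 dS) => _ ->. Qed.

Lemma prob_Ex S E w : depends S E -> prob E = Ex (undup S) (fun w => (E w)%:R) w.
Proof. by move=> dS; rewrite /prob; case: (event_Ex w dS) => _ ->. Qed.

Lemma prob_ge0 E : 0 <= prob E.
Proof. by rewrite fine_ge0. Qed.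

Lemma prob_not E : finite_event E -> prob (fun w => ~~ E w) = 1 - prob E.
Proof.
move=> [S dE]; rewrite (prob_Ex w0 (depends_comp negb dE)) (prob_Ex w0 dE).
rewrite -[X in X - _](Ex_cst (undup S) 1 w0) -ExB; congr Ex; apply/funext => w /=.
by case: (E w); rewrite ?subr0 ?subrr.
Qed.

Lemma prob_le E E' : finite_event E -> finite_event E' -> (forall w, E w -> E' w) ->
  prob E <= prob E'.
Proof.
move=> fE fE' EE; rewrite -lee_fin -!probE//; apply: le_measure.
- by rewrite inE; exact: measurable_event.
- by rewrite inE; exact: measurable_event.
- by move=> t; exact: EE.
Qed.

Lemma prob_le1 E : finite_event E -> prob E <= 1.
Proof. by move=> fE; have := prob_ge0 (fun w => ~~ E w); rewrite prob_not// subr_ge0. Qed.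

(** Independence: averaging first over the labels of [S'] leaves [E] unchanged and
    turns [E'] into the constant [prob E']. *)
Lemma prob_and S S' E E' : depends S E -> depends S' E' -> {in S, forall e, e \notin S'} ->
  prob (fun w => E w && E' w) = prob E * prob E'.
Proof.
move=> dE dE' disj.
have d : depends (undup S ++ undup S') (fun w => E w && E' w).
  apply: depends_comp2.
    by apply: depends_sub dE => x; rewrite mem_cat mem_undup => ->.
  by apply: depends_sub dE' => x; rewrite mem_cat !mem_undup orbC => ->.
have u : uniq (undup S ++ undup S').
  rewrite cat_uniq !undup_uniq/= andbT; apply/hasPn => x.
  by rewrite !mem_undup => xS'; apply/negP => /disj; rewrite xS'.
rewrite (prob_Ex w0 d) undup_id// (prob_Ex w0 dE) mulrC Ex_cat -ExZ; congr Ex.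
apply/funext => w; rewrite (prob_Ex w dE') mulrC -(@Ex_mul _ S (fun w => (E w)%:R)).
- by congr Ex; apply/funext => w'; case: (E w'); rewrite ?mul1r ?mul0r.
- by move=> v v' e; rewrite (dE _ _ e).
- by move=> x /disj; rewrite mem_undup.
Qed.

Lemma prob_shift u E : finite_event E -> prob (E \o shift u) = prob E.
Proof.
move=> [S dE]; rewrite (prob_Ex w0 (depends_shift (u := u) dE)).
have inj : injective (@shift_edge M u).
  move=> [x a] [y b] [] /eqP; rewrite eqseq_cat// eqxx/= => /eqP -> ->//.
rewrite (undup_map_inj inj) (Ex_shift _ _ (fun w => (E w)%:R)).
by rewrite -(prob_Ex _ dE).
Qed.

Lemma prob_label e i : prob (fun w => w e == i) = p i.
Proof.
have [_ _ hp] := homega.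
have : finite_event (fun w => w e == i).
  by exists [:: e] => w w' h; rewrite h// mem_head.
move=> /probE; rewrite (_ : event _ = omega e @^-1` [set i]) ?hp => [[]//|].
by apply/seteqP; split => t /eqP.
Qed.

Lemma prob_lab u x : size x = size u -> prob (fun w => lab w u == x) = wratio p x.
Proof.
elim: u x => [|a u IH] [|i x]//=.
  have -> : (fun=> [::] == [::] :> seq 'I_N) = (fun w : labelling => ~~ false) by [].
  have f0 : finite_event (fun _ : labelling => false) by exists [::].
  rewrite prob_not// /wratio big_nil (prob_Ex (S := [::]) w0)// subr0//.
move=> [sx]; rewrite /wratio big_cons -/(wratio p x) -(IH x sx).
have [S dS _] := depends_lab N u.
have dS' := depends_shift (u := [:: a]) (depends_comp (eq_op^~ x) dS).
have de : depends [:: ([::], a)] (fun w : labelling => w ([::], a) == i).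
  by move=> w w' h; rewrite h// mem_head.
rewrite -(prob_shift [:: a] (finite_event_lab u (eq_op^~ x))) -(prob_label ([::], a)).
rewrite -(prob_and de dS')//.
by move=> e; rewrite inE => /eqP ->; apply/negP => /mapP[].
Qed.

Lemma prob_shift_disjoint u v E E' : size u = size v -> u != v ->
  finite_event E -> finite_event E' ->
  prob (fun w => E (shift u w) && E' (shift v w)) = prob E * prob E'.
Proof.
move=> uv ne [S dE] [S' dE'].
rewrite (prob_and (depends_shift (u := u) dE) (depends_shift (u := v) dE')).
  by rewrite !prob_shift//; [exists S'|exists S].
move=> e /mapP[x _ ->]; apply/negP => /mapP[y _ []] /eqP.
by rewrite eqseq_cat// (negbTE ne).
Qed.

End Expectation.

(** * Trees of distinct words inside the random tree *)

Section RandomTree.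
Variables (R : realType) (N M : nat) (p : 'I_N -> R).
Hypothesis p1 : \sum_i p i = 1.
Hypothesis p0 : forall i, 0 < p i.
Variables (disp : measure_display) (T : measurableType disp) (Pr : probability T R).
Variable omega : edge M -> T -> 'I_N.
Hypothesis homega : iid_labels Pr p omega.
Variable w0 : labelling N M.
Hypothesis hM : (2 <= M)%N.
Implicit Types (H E : labelling N M -> bool).

Local Notation prob := (prob Pr omega).
Local Notation event := (event omega).

Lemma prob_exists_le (I : finType) (A : I -> labelling N M -> bool) :
  (forall i, finite_event (A i)) ->
  prob (fun w => [exists i, A i w]) <= \sum_i prob (A i).
Proof.
move=> /finite_event_common[S dS].
have dE : depends S (fun w => [exists i, A i w]).
  by move=> w w' e; apply: eq_existsb => i; apply: dS.
rewrite (prob_Ex homega w0 dE).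
under eq_bigr => i _ do rewrite (prob_Ex homega w0 (dS i)).
rewrite -Ex_sum; apply: Ex_le => [i|w]; first exact: ltW.
case: existsP => [[i Ai]|_]; last by apply: sumr_ge0 => i _; rewrite ler0n.
by rewrite (bigD1 i)//= Ai lerDl sumr_ge0.
Qed.

(** Bonferroni's inequality: if [k] of the events occur then [k - (k ^ 2 - k)] is at
    most 1, and at most 0 when [k = 0]. *)
Lemma prob_exists_ge (I : finType) (A : I -> labelling N M -> bool) (c : R) :
  (forall i, finite_event (A i)) -> 0 <= c ->
  (forall i j, i != j -> prob (fun w => A i w && A j w) <= c) ->
  \sum_i prob (A i) - #|I|%:R ^+ 2 * c <= prob (fun w => [exists i, A i w]).
Proof.
move=> fA c0 Ac; have [S dS] := finite_event_common fA.
have dE : depends S (fun w => [exists i, A i w]).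
  by move=> w w' e; apply: eq_existsb => i; apply: dS.
have d2 i j : depends S (fun w => A i w && A j w) by apply: depends_comp2.
apply: (@le_trans _ _ (\sum_i prob (A i) -
   \sum_i \sum_(j | j != i) prob (fun w => A i w && A j w))).
  rewrite lerD2l lerN2.
  apply: (@le_trans _ _ (\sum_(i : I) \sum_(j : I) c)).
    apply: ler_sum => i _; rewrite big_mkcond/=; apply: ler_sum => j _.
    by case: ifP => // ji; rewrite Ac// eq_sym.
  by rewrite !sumr_const -mulrnA -[leLHS]mulr_natl natrM expr2.
rewrite (prob_Ex homega w0 dE).
under eq_bigr => i _ do rewrite (prob_Ex homega w0 (dS i)).
under [X in _ - X]eq_bigr => i _.
  under eq_bigr => j _ do rewrite (prob_Ex homega w0 (d2 i j)).
  rewrite big_mkcond/=.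
  under eq_bigr => j _ do rewrite -[X in if _ then X else _]mul1r
     -[X in if _ then _ else X](mul0r (Ex p (undup S) (fun w => (A i w && A j w)%:R) w0))
     -(fun_if (fun x => x * _)) -ExZ.
  rewrite -Ex_sum.
  over.
rewrite -!Ex_sum -ExB; apply: Ex_le => [i|w]; first exact: ltW.
pose k : R := \sum_i (A i w)%:R.
have -> : \sum_i \sum_j (if j != i then 1 else 0) * (A i w && A j w)%:R = k ^+ 2 - k.
  rewrite expr2 {1}/k mulr_suml /k -sumrB; apply: eq_bigr => i _.
  rewrite (bigD1 i)//= eqxx mul0r add0r [in RHS](bigD1 i)//=.
  have -> : \sum_(j | j != i) (if j != i then 1 else 0) * (A i w && A j w)%:R =
      (A i w)%:R * \sum_(j | j != i) (A j w)%:R :> R.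
    by rewrite mulr_sumr; apply: eq_bigr => j ->; rewrite mul1r -mulnb natrM.
  rewrite mulrDr -natrM mulnb andbb; ring.
rewrite -/k; case: existsP => [_|h].
  by rewrite mulr1n; have := sqr_ge0 (k - 1); rewrite sqrrB mulr1 expr1n mulr2n; lra.
have -> : k = 0.
  by rewrite /k big1// => i _; case Ai : (A i w) => //; case: h; exists i.
by rewrite expr0n/= !subr0.
Qed.

Lemma prob_lab_mem u (c : seq (seq 'I_N)) : uniq c ->
  (forall x, x \in c -> size x = size u) ->
  prob (fun w => lab w u \in c) = \sum_(x <- c) wratio p x.
Proof.
have [S dS _] := depends_lab N u.
move=> uc sc; rewrite (prob_Ex homega w0 (depends_comp (fun x => x \in c) dS)).
transitivity (\sum_(x <- c) prob (fun w => lab w u == x)); last first.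
  by apply: eq_big_seq => x xc; rewrite (prob_lab p1 homega w0)// sc.
under [RHS]eq_bigr => x _ do
  rewrite (prob_Ex homega w0 (depends_comp (eq_op^~ x) dS)).
rewrite -Ex_sum; congr Ex; apply/funext => w /=.
have [xc|xc] := boolP (lab w u \in c).
  rewrite (bigD1_seq _ xc uc)/= eqxx big1 ?addr0// => y /negbTE.
  by rewrite eq_sym => ->.
rewrite big_seq big1// => y yc; case: eqP => // e.
by rewrite e yc in xc.
Qed.

(** Subtrees at different vertices of one level have no edge in common. *)
Lemma prob_all_shift m (s : seq (seq 'I_M)) E : uniq s -> finite_event E ->
  (forall u, u \in s -> size u = m) ->
  prob (fun w => all (fun u => E (shift u w)) s) = prob E ^+ size s.
Proof.
move=> us [S dE] sm.
pose D s := flatten [seq map (shift_edge u) S | u <- s].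
have dD s' : depends (D s') (fun w => all (fun u => E (shift u w)) s').
  elim: s' => [|u s' IH]; first by move=> w w'.
  apply: (@depends_comp2 _ _ _ _ _ _ (E \o shift u) _ andb).
    by apply: (depends_sub _ (depends_shift (u := u) dE)) => x xS; rewrite mem_cat xS.
  by apply: depends_sub IH => x xS; rewrite mem_cat xS orbT.
elim: s us sm => [|u s IH] /=.
  move=> _ _; rewrite (prob_Ex homega (S := [::]) w0)//.
case/andP => us uns sm; rewrite exprS -IH// => [|v vs]; last first.
  by rewrite sm// inE vs orbT.
have fE : finite_event E by exists S.
rewrite -[X in X * _](prob_shift homega w0 u fE).
apply: (prob_and homega w0 (depends_shift (u := u) dE) (dD s)).
move=> e /mapP[x _ ->]; apply/negP => /flattenP[l /mapP[v vs ->]] /mapP[y _ []].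
move=> /eqP; rewrite eqseq_cat; last by rewrite !sm ?mem_head// inE vs orbT.
by case: eqP => // uv; rewrite uv vs in us.
Qed.

Lemma prob_forall_tuple m E : finite_event E ->
  prob (fun w => [forall u : m.-tuple 'I_M, E (shift u w)]) = prob E ^+ (M ^ m).
Proof.
move=> fE.
have := @prob_all_shift m [seq val u | u <- enum {: m.-tuple 'I_M}] E.
rewrite size_map -cardE card_tuple card_ord => <- //.
- congr prob; apply/funext => w; rewrite all_map; apply/forallP/allP => /= h u.
    by move=> _; exact: h.
  by apply: h; rewrite mem_enum.
- by rewrite map_inj_uniq ?enum_uniq//; exact: val_inj.
- by move=> _ /mapP[u _ ->]; rewrite size_tuple.
Qed.

(** The number of descendants at depth [L] that are reached by a word of [c] has
    mean at least two, so surviving one more block preserves a small enough lower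
    bound [y0] on the survival probability: below [M^(-2 L)] the pairs in
    Bonferroni's inequality cost at most one of the two expected descendants, and
    above it a single descendant is enough. *)
Lemma colour_step L (c : seq (seq 'I_N)) H (y0 : R) : uniq c ->
  (forall x, x \in c -> size x = L) ->
  2 <= M%:R ^+ L * \sum_(x <- c) wratio p x ->
  0 <= y0 <= (M%:R ^+ L) ^- 3 -> finite_event H -> y0 <= prob H ->
  y0 <= prob (fun w => [exists u : L.-tuple 'I_M, (lab w u \in c) && H (shift u w)]).
Proof.
move=> uc sc c2 /andP[y00 y0M] fH yH.
set pc := \sum_(x <- c) _ in c2; set m := M%:R ^+ L in c2 y0M.
have m0 : 1 <= m by rewrite exprn_ege1// ler1n ltnW.
have fA (u : L.-tuple 'I_M) : finite_event (fun w => (lab w u \in c) && H (shift u w)).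
  apply: finite_event_and; first exact: (finite_event_lab u (fun x => x \in c)).
  exact: finite_event_shift.
have pA (u : L.-tuple 'I_M) :
    prob (fun w => (lab w u \in c) && H (shift u w)) = pc * prob H.
  have [S dS sS] := depends_lab N u.
  have [S' dH] := fH.
  rewrite (prob_and homega w0 (depends_comp (fun x => x \in c) dS)
     (depends_shift dH)).
    rewrite (prob_lab_mem uc) => [|x /sc]; last by rewrite size_tuple.
    by rewrite (prob_shift homega w0).
  move=> e /sS se; apply/negP => /mapP[x _ ex].
  by move: se; rewrite ex/= size_cat ltnNge leq_addr.
have y1 := prob_le1 p1 homega w0 fH.
set y := prob H in yH y1 pA *.
have y_ge0 : 0 <= y by exact: prob_ge0.
have [ysmall|ybig] := leP y (m ^- 2).
  have := @prob_exists_ge _ (fun (u : L.-tuple 'I_M) w => (lab w u \in c) && H (shift u w))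
     (y ^+ 2) fA (sqr_ge0 _).
  rewrite card_tuple card_ord natrX -/m => h.
  apply: le_trans (h _) => [|u v uv].
    under eq_bigr => u _ do rewrite pA.
    rewrite sumr_const card_tuple card_ord -mulr_natl natrX -/m mulrA.
    have h1 : 2 * y <= m * pc * y by rewrite ler_wpM2r.
    have h2 : m ^+ 2 * y ^+ 2 <= y.
      have -> : m ^+ 2 * y ^+ 2 = (y * m ^+ 2) * y by ring.
      have ym : y * m ^+ 2 <= 1.
        by rewrite -ler_pdivlMr ?mul1r// exprn_gt0//; lra.
      by rewrite ler_piMl.
    lra.
  apply: (@le_trans _ _ (prob (fun w => H (shift u w) && H (shift v w)))).
    apply: (prob_le homega w0).
    - exact: finite_event_and.
    - by apply: finite_event_and; exact: finite_event_shift.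
    - by move=> w /andP[/andP[_ ->] /andP[_ ->]].
  rewrite (prob_shift_disjoint homega w0)//.
  by rewrite !size_tuple.
pose u0 : L.-tuple 'I_M := [tuple of nseq L (Ordinal (ltnW hM : (0 < M)%N))].
apply: (@le_trans _ _ (pc * y)).
  apply: le_trans y0M _.
  have m3 : 0 < m ^+ 3 by rewrite exprn_gt0//; lra.
  rewrite -[leLHS]mul1r ler_pdivrMr//.
  have ym : 1 <= y * m ^+ 2.
    by rewrite -ler_pdivrMr ?mul1r ?ltW// exprn_gt0//; lra.
  have -> : pc * y * m ^+ 3 = (m * pc) * (y * m ^+ 2) by ring.
  nra.
rewrite -(pA u0); apply: (prob_le homega w0) => //.
  exact: finite_event_exists.
by move=> w h; apply/existsP; exists u0.
Qed.

Fixpoint chain L (cs : seq (seq (seq 'I_N))) H (w : labelling N M) : bool :=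
  if cs is c :: cs' then
    [exists u : L.-tuple 'I_M, (lab w u \in c) && chain L cs' H (shift u w)]
  else H w.

Fixpoint matches L (cs : seq (seq (seq 'I_N))) (x : seq 'I_N) : bool :=
  if cs is c :: cs' then (take L x \in c) && matches L cs' (drop L x) else x == [::].

Lemma finite_event_chain L cs H : finite_event H -> finite_event (chain L cs H).
Proof.
move=> fH; elim: cs => //= c cs IH; apply: finite_event_exists => u.
apply: finite_event_and; first exact: (finite_event_lab u (fun x => x \in c)).
exact: finite_event_shift.
Qed.

Lemma chain_vertex L cs H w : chain L cs H w ->
  exists u : seq 'I_M, [/\ size u = (size cs * L)%N, matches L cs (lab w u) & H (shift u w)].
Proof.
elim: cs w => [|c cs IH] w /=; first by exists [::]; rewrite shift_nil.
move=> /existsP[u /andP[uc /IH[v [sv mv Hv]]]]; exists (u ++ v).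
rewrite size_cat sv size_tuple mulSn lab_cat shift_cat.
rewrite take_size_cat ?size_lab ?size_tuple// drop_size_cat ?size_lab ?size_tuple//.
by rewrite uc.
Qed.

Variables (K : finType) (n : nat) (Q : K -> seq 'I_N -> bool).

(** A [K]-ary tree of depth [k] whose edges are paths of [n] edges, labelled by
    words of the prescribed kinds. *)
Fixpoint good (k : nat) (w : labelling N M) : bool :=
  if k is k'.+1 then
    [forall a : K, [exists u : n.-tuple 'I_M, Q a (lab w u) && good k' (shift u w)]]
  else true.

Lemma finite_event_branch H : finite_event H -> finite_event
  (fun w => [forall a : K, [exists u : n.-tuple 'I_M, Q a (lab w u) && H (shift u w)]]).
Proof.
move=> fH; apply: finite_event_forall => a; apply: finite_event_exists => u.
apply: finite_event_and; first exact: (finite_event_lab u).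
exact: finite_event_shift.
Qed.

Lemma finite_event_good k : finite_event (good k).
Proof. by elim: k => [|k IH] /=; [exists [::]|exact: finite_event_branch]. Qed.

Lemma good_anti k l w : (k <= l)%N -> good l w -> good k w.
Proof.
elim: k l w => [//|k IH] [//|l] w /= kl /forallP h; apply/forallP => a.
have /existsP[u /andP[Qu gu]] := h a; apply/existsP; exists u; rewrite Qu/=.
exact: IH gu.
Qed.

(** Koenig's lemma: a node with finitely many choices that works to every depth has
    a choice that works to every depth. *)
Lemma good_branch w : (forall k, good k w) ->
  forall a, exists u : n.-tuple 'I_M, Q a (lab w u) /\ forall k, good k (shift u w).
Proof.
move=> gw a; apply: contrapT => nex.
have /choice[k hk] : forall u : n.-tuple 'I_M,
    exists k, ~~ (Q a (lab w u) && good k (shift u w)).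
  move=> u; apply: contrapT => h; apply: nex; exists u.
  have {}h k : Q a (lab w u) && good k (shift u w).
    by apply: contrapT => h'; apply: h; exists k; exact/negP.
  by split=> [|k]; have /andP[] := h 0; [|have /andP[] := h k].
pose m := \max_u k u.
have /= /forallP/(_ a)/existsP[u /andP[Qu gu]] := gw m.+1.
have := hk u; rewrite Qu/= => /negP; apply; apply: good_anti gu.
exact: (leq_bigmax u).
Qed.

Variable y0 : R.
Hypothesis y01 : 0 < y0 <= 1.
Hypothesis reliable : forall H, finite_event H -> y0 <= prob H -> y0 <=
  prob (fun w => [forall a : K, [exists u : n.-tuple 'I_M, Q a (lab w u) && H (shift u w)]]).

Lemma prob_good k : y0 <= prob (good k).
Proof.
elim: k => [|k IH] /=; last by apply: reliable => //; exact: finite_event_good.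
have -> : prob (fun=> true) = 1.
  by rewrite (prob_Ex homega (S := [::]) w0).
by case/andP: y01.
Qed.

(** A vertex of depth [l] starts an infinite tree with probability at least [y0],
    independently of the others, and there are [M ^ l] of them. *)
Lemma infinite_tree_ae :
  {ae Pr, forall t, exists u : seq 'I_M, forall k, good k (shift u (labels omega t))}.
Proof.
pose B l k := event (fun w => [forall u : l.-tuple 'I_M, ~~ good k (shift u w)]).
have fB l k : finite_event
    (fun w : labelling N M => [forall u : l.-tuple 'I_M, ~~ good k (shift u w)]).
  apply: finite_event_forall => u; apply: finite_event_not.
  exact: finite_event_shift (finite_event_good k).
have mB l k : measurable (B l k) by apply: (measurable_event homega w0).
have PB l k : (Pr (B l k) <= ((1 - y0) ^+ (M ^ l))%:E)%E.
  rewrite (probE homega w0)// lee_fin.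
  have fg := finite_event_good k.
  rewrite (prob_forall_tuple l (finite_event_not fg)) (prob_not p1 homega w0)//.
  have g1 := prob_good k; have g2 := prob_le1 p1 homega w0 fg.
  rewrite lerXn2r ?nnegrE ?subr_ge0//; last by rewrite lerD2l lerN2.
  by case/andP: y01.
have mBB l : measurable (\bigcup_k B l k) by apply: bigcup_measurable.
have PBB l : (Pr (\bigcup_k B l k) <= ((1 - y0) ^+ (M ^ l))%:E)%E.
  have cv : (Pr \o B l) @ \oo --> Pr (\bigcup_k B l k).
    apply: nondecreasing_cvg_mu => // i j ij; apply/subsetPset => t.
    rewrite /B /event/= => /forallP h; apply/forallP => u.
    by apply: contra (h u); exact: good_anti.
  rewrite -(cvg_lim _ cv)//; apply: lime_le; first exact: cvgP cv.
  by apply: nearW => k; exact: PB.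
have mall : measurable (\bigcap_l \bigcup_k B l k).
  by apply: bigcap_measurable => //; exists 0%N.
exists (\bigcap_l \bigcup_k B l k); split => //.
- apply/eqP; rewrite eq_le measure_ge0 andbT; apply/lee_addgt0Pr => e e0.
  rewrite add0e.
  have : (fun l => (1 - y0) ^+ l) @ \oo --> (0 : R).
    by apply: cvg_expr; case/andP: y01 => a b; rewrite ger0_norm; lra.
  move/cvgrPdist_lt => /(_ _ e0)[l _ hl].
  have {}hl := hl (M ^ l)%N (ltnW (ltn_expl l hM)).
  apply: le_trans (le_trans (PBB l) _).
    by apply: le_measure; rewrite ?inE//; exact: bigcap_inf.
  by rewrite lee_fin; move: hl; rewrite sub0r normrN => /ltW; exact/le_trans/ler_norm.
- move=> t /= h l _; apply: contrapT => nB; apply: h.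
  apply: contrapT => h.
  have /choice[k hk] : forall u : l.-tuple 'I_M,
      exists k, ~~ good k (shift u (labels omega t)).
    move=> u; apply: contrapT => h'; apply: h; exists u => k.
    by apply: contrapT => h''; apply: h'; exists k; exact/negP.
  apply: nB; exists (\max_u k u) => //; apply/forallP => u.
  by apply: contra (hk u); apply: good_anti; exact: (leq_bigmax u).
Qed.

End RandomTree.

Lemma expn_beats_linear (R : realType) (M : nat) (a b c : R) : (2 <= M)%N -> 0 < c ->
  0 <= a -> 0 <= b ->
  exists2 m, (0 < m)%N & a * m%:R + b <= c * (M ^ m)%:R.
Proof.
move=> hM c0 a0 b0.
pose k := (Num.truncn ((2 * a + b) / c)).+1.
have k1 : (2 * a + b) <= c * k%:R.
  by rewrite [leRHS]mulrC -ler_pdivrMr//; apply: ltW; exact: truncnS_gt.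
have kR : 1 <= k%:R :> R by rewrite ler1n.
exists (2 * k)%N => //; apply: (@le_trans _ _ (c * (k ^ 2)%:R)).
  rewrite natrX expr2 mulrA natrM.
  apply: (@le_trans _ _ ((2 * a + b) * k%:R)); first nra.
  by rewrite ler_wpM2r.
rewrite ler_pM2l// ler_nat mulnC expnM leq_exp2r//.
exact: ltnW (ltn_expl _ _).
Qed.

Section WordTree.
Variables (R : realType) (N M : nat) (p r : 'I_N -> R).
Hypothesis p1 : \sum_i p i = 1.
Hypothesis p0 : forall i, 0 < p i.
Hypothesis hr : forall i, 0 < r i < 1.
Variables (disp : measure_display) (T : measurableType disp) (Pr : probability T R).
Variable omega : edge M -> T -> 'I_N.
Hypothesis homega : iid_labels Pr p omega.
Variable w0 : labelling N M.
Hypothesis hM : (2 <= M)%N.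

Lemma matches_ratio L (rho : R) (cs : seq (seq (seq 'I_N))) x :
  (forall c, c \in cs -> forall w, w \in c -> wratio r w = rho) ->
  matches L cs x -> wratio r x = rho ^+ size cs.
Proof.
elim: cs x => [|c cs IH] x hc /=; first by move=> /eqP ->; rewrite /wratio big_nil.
move=> /andP[xc /IH h]; rewrite -(cat_take_drop L x) wratio_cat (hc c)//; last first.
  by rewrite mem_head.
by rewrite h ?exprS// => c' c'cs; apply: hc; rewrite inE c'cs orbT.
Qed.

Lemma matches_inj L (C : eqType) (col : C -> seq (seq 'I_N)) (a b : seq C) x :
  (forall c c' w, w \in col c -> w \in col c' -> c = c') -> size a = size b ->
  matches L (map col a) x -> matches L (map col b) x -> a = b.
Proof.
move=> hc; elim: a b x => [|c a IH] [|c' b] x //= [sab] /andP[ca ma] /andP[cb mb].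
by rewrite (hc _ _ _ ca cb) (IH _ _ sab ma mb).
Qed.

(** Each node first branches freely for [m] generations, which gives [M ^ m]
    independent attempts at each of the [B ^ j] colour words: with [m] of order
    [ln j], every colour word is found with large probability, while the ratios
    lose only a factor [a ^ m], smaller than the gain [(B * rho `^ s) ^ j]. *)
Lemma word_tree_ae (q : 'I_N -> R) (s : R) :
  (forall i, 0 < q i) -> \sum_i q i = 1 -> 0 < s ->
  0 < \sum_i q i * ln (r i `^ s / q i) ->
  0 < \sum_i q i * ln (r i `^ s * (M%:R * p i) / q i) ->
  exists (K : finType) (n : nat) (sigma : R) (Q : K -> seq 'I_N -> bool),
  [/\ (0 < n)%N /\ 0 < sigma < 1,
      forall a x, Q a x -> size x = n /\ sigma <= wratio r x,
      forall a b x, Q a x -> Q b x -> a = b,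
      1 <= #|K|%:R * sigma `^ s
    & {ae Pr, forall t, exists u : seq 'I_M,
        forall k, good n Q k (shift u (labels omega t))}].
Proof.
move=> q0 q1 s0 h1 h2.
have M0 : (0 < M)%N by exact: ltnW.
have [L [B [rho [col [hcol ucol dcol pcol [rho0 Brho]]]]]] :=
  colour_family M0 p0 hr q0 q1 s0 h1 h2.
have [[a b] /= /andP[a0 ab] [b1 hab]] := ratio_bounds hr.
have a1 : a < 1 by exact: le_lt_trans ab b1.
have rhos0 : 0 < rho `^ s by exact: powR_gt0.
have B0 : (0 < B)%N.
  by rewrite lt0n; apply/eqP => B0; move: Brho; rewrite B0 mul0r ltr10.
have rho1 : rho <= 1.
  pose c := Ordinal B0; have := pcol c.
  case E : (col c) => [|w l]; first by rewrite big_nil mulr0 lern0.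
  have wc : w \in col c by rewrite E mem_head.
  by move=> _; have [_ <-] := hcol _ _ wc; exact: wratio_le1.
have rhos1 : rho `^ s <= 1.
  by rewrite -(powRr0 rho); apply: ger_powR; rewrite ?rho0//= ltW.
have B1 : 1 < B%:R :> R by nra.
pose y0 : R := (M%:R ^+ L) ^- 3 / 2.
have ML : 1 <= M%:R ^+ L :> R by rewrite exprn_ege1// ler1n.
have y00 : 0 < y0 by rewrite divr_gt0// invr_gt0 !exprn_gt0// ltr0n.
have yM : y0 <= (M%:R ^+ L) ^- 3.
  by rewrite ler_pdivrMr// ler_peMr ?ler1n// invr_ge0 !exprn_ge0.
have y0h : y0 <= 2^-1.
  have h3 : 1 <= (M%:R ^+ L) ^+ 3 :> R by exact: exprn_ege1.
  by rewrite /y0 -[leRHS]mul1r ler_pM2r// invf_le1//; lra.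
have lnbeta : 0 < ln (B%:R * rho `^ s) by exact: ln_gt0.
have lnB : 0 < ln B%:R :> R by exact: ln_gt0.
pose c1 := s * ln a^-1.
have c10 : 0 < c1 by rewrite mulr_gt0// ln_gt0// invf_gt1.
pose A := c1 / ln (B%:R * rho `^ s).
have A0 : 0 < A by rewrite divr_gt0.
have [||m m0 hm] := @expn_beats_linear R M (A * ln B%:R) (ln B%:R + ln 2) y0 hM y00.
- by rewrite mulr_ge0// ltW.
- by rewrite addr_ge0 ?ln_ge0 ?ler1n// ltW.
pose j := (Num.truncn (A * m%:R)).+1.
have j1 : A * m%:R <= j%:R by apply: ltW; exact: truncnS_gt.
have j2 : j%:R <= A * m%:R + 1.
  by rewrite -natr1 lerD2r truncn_le// mulr_ge0// ltW.
pose K : finType := {: j.-tuple 'I_B}.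
have cardK : #|K| = (B ^ j)%N by rewrite card_tuple card_ord.
pose n := (m + j * L)%N.
pose Q (a : K) (x : seq 'I_N) := (size x == n) && matches L (map col (val a)) (drop m x).
have Kfail : (#|K|)%:R * (1 - y0) ^+ (M ^ m) <= 2^-1.
  have e1 : 1 - y0 <= expR (- y0) by rewrite -[1 - y0]/(1 + - y0) expR_ge1Dx.
  apply: (@le_trans _ _ (expR (j%:R * ln B%:R) * expR (- (y0 * (M ^ m)%:R)))).
    apply: ler_pM => //; first by rewrite exprn_ge0//; lra.
      by rewrite cardK natrX expRM_natl lnK// posrE ltr0n.
    have -> : - (y0 * (M ^ m)%:R) = (M ^ m)%:R * (- y0) by rewrite mulrN mulrC.
    rewrite expRM_natl lerXn2r ?nnegrE ?expR_ge0//; lra.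
  rewrite -expRD -[leRHS]lnK ?posrE ?invr_gt0// ler_expR lnV ?posrE//.
  have : j%:R * ln B%:R <= A * ln B%:R * m%:R + ln B%:R.
    by rewrite mulrAC -[X in _ <= _ + X]mul1r -mulrDl ler_wpM2r// ltW.
  lra.
pose sigma := a ^+ m * rho ^+ j.
exists K, n, sigma, Q; split.
- rewrite /n addn_gt0 m0; split=> //.
  rewrite /sigma mulr_gt0 ?exprn_gt0//=.
  apply: (@le_lt_trans _ _ (a ^+ m)).
    apply: ler_piMr; first by rewrite exprn_ge0// ltW.
    by apply: exprn_ile1 => //; exact: ltW.
  by rewrite exprn_ilt1 ?(ltW a0)// -lt0n.
- move=> c x /andP[/eqP sx mx]; split=> //.
  rewrite -(cat_take_drop m x) wratio_cat /sigma; apply: ler_pM.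
  + by rewrite exprn_ge0// ltW.
  + by rewrite exprn_ge0// ltW.
  + have := @wratio_ge _ _ r a (take m x) (ltW a0).
    rewrite size_takel ?sx ?leq_addr//; apply => i.
    by case/andP: (hab i).
  + rewrite (matches_ratio _ mx (rho := rho)) ?size_map ?size_tuple//.
    by move=> _ /mapP[c' _ ->] w /hcol[].
- move=> c c' x /andP[_ mx] /andP[_ mx']; apply: val_inj.
  by apply: matches_inj dcol _ mx mx'; rewrite !size_tuple.
- rewrite cardK natrX /sigma powRM ?exprn_ge0 ?(ltW a0) ?(ltW rho0)//.
  rewrite -!powR_expr ?(ltW a0) ?(ltW rho0)// mulrCA -exprMn.
  have -> : a `^ s = expR (- c1).
    by rewrite /powR gt_eqF// /c1 lnV ?posrE// mulrN opprK.
  rewrite -[B%:R * _]lnK ?posrE; last exact: lt_trans Brho.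
  rewrite -!expRM_natl -expRD -[leLHS]expR0 ler_expR.
  have : m%:R * c1 <= j%:R * ln (B%:R * rho `^ s).
    have -> : c1 = A * ln (B%:R * rho `^ s) by rewrite /A divfK// gt_eqF.
    by rewrite mulrA ler_wpM2r ?(ltW lnbeta)// mulrC.
  lra.
apply: (infinite_tree_ae p1 homega w0 hM (y0 := y0)).
  by rewrite y00; lra.
move=> H fH yH.
have ychain cs : {subset cs <= codom col} -> y0 <= prob Pr omega (chain L cs H).
  elim: cs => [|c cs IH] sub //=.
  have /codomP[i ->] : c \in codom col by apply: sub; rewrite mem_head.
  apply: (colour_step p1 p0 homega w0 hM (ucol i)) => //.
  - by move=> x /hcol[].
  - by rewrite (ltW y00).
  - exact: finite_event_chain.
  - by apply: IH => x xcs; apply: sub; rewrite inE xcs orbT.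
pose F (c : K) w := [forall v : m.-tuple 'I_M, ~~ chain L (map col (val c)) H (shift v w)].
have fF c : finite_event (F c).
  apply: finite_event_forall => v; apply: finite_event_not.
  by apply: finite_event_shift; exact: finite_event_chain.
have fE := finite_event_exists fF.
apply: (@le_trans _ _ (prob Pr omega (fun w => ~~ [exists c, F c w]))); last first.
  apply: (prob_le homega w0); first exact: finite_event_not.
    exact: finite_event_branch.
  move=> w; rewrite negb_exists => /forallP h; apply/forallP => c.
  have := h c; rewrite negb_forall => /existsP[v]; rewrite negbK.
  move=> /chain_vertex[u [su mu Hu]].
  have svu : size (val v ++ u) == n.
    by rewrite size_cat size_tuple su size_map size_tuple.
  apply/existsP; exists (Tuple svu); rewrite /Q/= size_lab svu/= lab_cat.
  by rewrite drop_size_cat ?size_lab ?size_tuple// mu shift_cat.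
rewrite (prob_not p1 homega w0)//.
have : prob Pr omega (fun w => [exists c, F c w]) <= 2^-1.
  apply: le_trans (prob_exists_le p0 homega w0 fF) _.
  apply: le_trans Kfail; rewrite mulr_natl -sumr_const; apply: ler_sum => c _.
  have fc : finite_event (chain L (map col (val c)) H) by exact: finite_event_chain.
  rewrite (prob_forall_tuple homega w0 m (finite_event_not fc)).
  rewrite (prob_not p1 homega w0)//.
  have g1 : y0 <= prob Pr omega (chain L (map col (val c)) H).
    by apply: ychain => _ /mapP[i _ ->]; exact: codom_f.
  have g2 := prob_le1 p1 homega w0 fc.
  by rewrite lerXn2r ?nnegrE ?subr_ge0//; lra.
lra.
Qed.

End WordTree.

(** * Hausdorff measure: mass distribution principle and covers *)

Section Hausdorff.
Variables (R : realType) (d : nat).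
Implicit Types (A C F : set 'rV[R]_d).

Lemma diam_ge A x y : A x -> A y -> ((enorm (x - y))%:E <= diam A)%E.
Proof. by move=> Ax Ay; apply: ereal_sup_ubound; exists x => //; exists y. Qed.

Lemma diam_ge0 A : A !=set0 -> (0 <= diam A)%E.
Proof. by move=> [x Ax]; have := diam_ge Ax Ax; rewrite subrr enorm0. Qed.

Lemma diam_le A (c : R) : (forall x y, A x -> A y -> enorm (x - y) <= c) ->
  (diam A <= c%:E)%E.
Proof. by move=> h; apply: ge_ereal_sup => _ [x Ax [y Ay <-]]; rewrite lee_fin h. Qed.

Lemma diam_pow_ge0 s A : (0 <= diam_pow s A)%E.
Proof. by rewrite /diam_pow; case: eqP => // _; exact: poweR_ge0. Qed.

Lemma premeasure_ge0 s delta A : (0 <= hausdorff_premeasure s delta A)%E.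
Proof.
apply: le_ereal_inf_tmp => _ [C _ <-]; apply: nneseries_ge0 => k _ _.
exact: diam_pow_ge0.
Qed.

Lemma hausdorff_measure_ge0 s A : (0 <= hausdorff_measure s A)%E.
Proof.
apply: (le_trans (premeasure_ge0 s 1 A)); apply: ereal_sup_ubound.
by exists 1 => //=; exact: ltr01.
Qed.

Lemma hausdorff_dim_ge (s : R) F :
  (forall s', 0 <= s' <= s -> hausdorff_measure s' F <> 0%E) ->
  (s%:E <= hausdorff_dim F)%E.
Proof.
move=> h; apply: le_ereal_inf_tmp => _ [s' [s'0 Hs'] <-]; rewrite lee_fin leNgt.
apply/negP => s's; apply: (h s') => //; by rewrite s'0 ltW.
Qed.

Lemma hausdorff_dim_le (s : R) F : 0 <= s -> hausdorff_measure s F = 0%E ->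
  (hausdorff_dim F <= s%:E)%E.
Proof. by move=> s0 h; apply: ereal_inf_lbound; exists s. Qed.

(** Lebesgue measure on [0, 1[, transported by [pt], charges a set of diameter
    [D] with at most a multiple of [D `^ s]; countable subadditivity then bounds
    the sums over covers from below.  The hypothesis is about positive [D]
    because a one-point set has diameter 0; the error [e / 2 ^ k] of the proof
    absorbs such sets. *)
Lemma mass_distribution (F : set 'rV[R]_d) (pt : R -> 'rV[R]_d) (a eta s : R) :
  0 < s -> 0 < a -> 0 < eta ->
  (forall x, 0 <= x < 1 -> F (pt x)) ->
  (forall C D, 0 < D < eta -> (forall x y, C x -> C y -> enorm (x - y) <= D) ->
    exists S : set R, [/\ measurable S,
      (forall x, 0 <= x < 1 -> C (pt x) -> S x) &
      (lebesgue_measure S <= (a * D `^ s)%:E)%E]) ->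
  forall s', 0 <= s' <= s -> hausdorff_measure s' F <> 0%E.
Proof.
move=> s0 a0 eta0 Fpt hC s' /andP[s'0 s's] H0.
pose delta := Num.min (eta / 2) 1.
have delta0 : 0 < delta by rewrite lt_min ltr01 divr_gt0.
have delta1 : delta <= 1 by rewrite ge_min lexx orbT.
have deltaeta : delta < eta.
  by rewrite gt_min ltr_pdivrMr// ltr_pMr// ltr1n.
pose e := (2 * (a + 1))^-1.
have e0 : 0 < e by rewrite invr_gt0 mulr_gt0// addr_gt0.
have : (hausdorff_premeasure s' delta F <= 0)%E.
  by rewrite -H0; apply: ereal_sup_ubound; exists delta.
move=> h0; have : (hausdorff_premeasure s' delta F < e%:E)%E.
  by apply: le_lt_trans h0 _; rewrite lte_fin.
move=> /ereal_inf_lt[_ [C [FC Cdelta] <-] Ce].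
have Sk k : exists S : set R, [/\ measurable S,
      (forall x, 0 <= x < 1 -> C k (pt x) -> S x) &
      (lebesgue_measure S <= a%:E * diam_pow s' (C k) + (e / (2 ^ k.+1)%:R)%:E)%E].
  have ek : 0 < e / (2 ^ k.+1)%:R by rewrite divr_gt0// ltr0n expn_gt0.
  have [C0|/set0P Cn0] := eqVneq (C k) set0.
    exists set0; split => //; first by move=> x _; rewrite C0.
    by rewrite measure0 adde_ge0 ?mule_ge0 ?diam_pow_ge0 ?lee_fin// ltW.
  have /set0P Cn0' := Cn0.
  have dfin : diam (C k) \is a fin_num.
    rewrite ge0_fin_numE ?diam_ge0//; apply: le_lt_trans (Cdelta k) _.
    by rewrite ltry.
  pose D := fine (diam (C k)).
  have DE : diam (C k) = D%:E by rewrite fineK.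
  have Dge0 : 0 <= D by rewrite fine_ge0// diam_ge0.
  have Dd : D <= delta by rewrite -lee_fin -DE.
  have CD x y : C k x -> C k y -> enorm (x - y) <= D.
    by move=> Cx Cy; rewrite -lee_fin -DE; exact: diam_ge.
  have dp : diam_pow s' (C k) = (D `^ s')%:E.
    by rewrite /diam_pow (negbTE Cn0') DE poweR_EFin.
  rewrite dp -EFinM -EFinD.
  have [D0|D0] := eqVneq D 0.
    pose D' := Num.min (delta / 2) ((e / (2 ^ k.+1)%:R / a) `^ s^-1).
    have D'0 : 0 < D' by rewrite lt_min divr_gt0//= powR_gt0// divr_gt0.
    have [||S [mS CS lS]] := hC (C k) D'.
    - rewrite D'0/= (le_lt_trans _ deltaeta)// ge_min ler_pdivrMr//.
      by rewrite ler_peMr// ?ler1n// ltW.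
    - by move=> x y Cx Cy; rewrite (le_trans (CD _ _ Cx Cy))// D0 ltW.
    exists S; split => //; apply: le_trans lS _; rewrite lee_fin.
    apply: (@le_trans _ _ (e / (2 ^ k.+1)%:R)); last first.
      by rewrite lerDr mulr_ge0 ?powR_ge0// ltW.
    rewrite mulrC -ler_pdivlMr//.
    have -> : e / (2 ^ k.+1)%:R / a = ((e / (2 ^ k.+1)%:R / a) `^ s^-1) `^ s.
      by rewrite -powRrM mulVf ?gt_eqF// powRr1// ltW// divr_gt0.
    by rewrite ge0_ler_powR ?nnegrE ?powR_ge0 ?(ltW s0) ?(ltW D'0)// ge_min lexx orbT.
  have D1 : 0 < D by rewrite lt_neqAle eq_sym D0.
  have [|//|S [mS CS lS]] := hC (C k) D.
    by rewrite D1 (le_lt_trans Dd).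
  exists S; split => //; apply: le_trans lS _; rewrite lee_fin.
  rewrite -[leLHS]addr0 lerD ?(ltW ek)// ler_wpM2l ?(ltW a0)//.
  by apply: ger_powR => //; rewrite D1 (le_trans Dd).
have /choice[S hS] := Sk.
have I01 : lebesgue_measure (`[0, 1[%classic : set R) = 1%E.
  by rewrite lebesgue_measure_itv/= lte01 oppr0 adde0.
have : (lebesgue_measure (`[0%R, 1%R[%classic : set R) <=
    \sum_(0 <= k <oo) lebesgue_measure (S k))%E.
  apply: measure_sigma_subadditive => //.
  - by move=> k; case: (hS k).
  - move=> x /=; rewrite in_itv/= => x01.
    have [k _ Ck] := FC _ (Fpt x x01); exists k => //.
    by case: (hS k) => _ h _; exact: h.
rewrite I01; apply/negP; rewrite -ltNge.
apply: (@le_lt_trans _ _ (\sum_(0 <= k <oo)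
   (a%:E * diam_pow s' (C k) + (e / (2 ^ k.+1)%:R)%:E))%E).
  by apply: lee_nneseries => k _ //; case: (hS k).
apply: le_lt_trans (epsilon_trick xpredT _ (ltW e0)) _.
  by move=> k; rewrite mule_ge0 ?diam_pow_ge0// lee_fin ltW.
rewrite nneseriesZl; last by move=> k _; exact: diam_pow_ge0.
apply: (@le_lt_trans _ _ (a%:E * e%:E + e%:E)%E).
  by rewrite leeD2r// lee_pmul2l// ltW.
rewrite -EFinM -EFinD lte_fin /e.
have -> : a * (2 * (a + 1))^-1 + (2 * (a + 1))^-1 = 2^-1.
  by field; rewrite gt_eqF// addr_gt0.
by rewrite invf_lt1 ?ltr1n.
Qed.

(** A finite cover becomes a sequence by adding empty sets, whose weight is 0. *)
Lemma hausdorff_measure_eq0 (F : set 'rV[R]_d) (s : R) :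
  (forall delta e : R, 0 < delta -> 0 < e ->
    exists2 l : seq (set 'rV[R]_d * R),
      (forall C : set 'rV[R]_d * R, C \in l -> 0 <= C.2 <= delta /\
         forall x y, C.1 x -> C.1 y -> enorm (x - y) <= C.2) &
      (forall x, F x -> exists2 C : set 'rV[R]_d * R, C \in l & C.1 x) /\
      \sum_(C <- l) C.2 `^ s <= e) -> 0 <= s ->
  hausdorff_measure s F = 0%E.
Proof.
move=> h s0; apply/eqP; rewrite eq_le hausdorff_measure_ge0 andbT.
apply: ge_ereal_sup => _ [delta /= delta0 <-]; apply/lee_addgt0Pr => e e0.
rewrite add0e; have [l hl [Fl le]] := h delta e delta0 e0.
pose C k := (nth (set0, 0) l k).1.
apply: (@le_trans _ _ (\sum_(0 <= k <oo) diam_pow s (C k))%E).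
  apply: ereal_inf_lbound; exists C => //; split.
    by move=> x /Fl[c cl cx]; exists (index c l) => //; rewrite /C nth_index.
  move=> k; apply: diam_le => x y; rewrite /C.
  case: (ltnP k (size l)) => [kl|kl]; last by rewrite nth_default.
  have [/andP[_ a] b] := hl _ (mem_nth (set0, 0) kl) => Cx Cy.
  exact: le_trans (b _ _ Cx Cy) a.
rewrite (nneseries_split 0 (size l)); last by move=> k _; exact: diam_pow_ge0.
rewrite add0n eseries0 ?adde0; last first.
  by move=> k kl _; rewrite /C nth_default// /diam_pow eqxx.
apply: (@le_trans _ _ (\sum_(C <- l) C.2 `^ s)%:E); last by rewrite lee_fin.
rewrite (big_nth (set0, 0)) -sumEFin big_nat [leRHS]big_nat.
apply: lee_sum => k /andP[_ kl]; rewrite /diam_pow /C.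
have [/andP[c0 _] b] := hl _ (mem_nth (set0, 0) kl).
case: eqP => [_|/eqP/set0P Cn0]; first by rewrite lee_fin powR_ge0.
rewrite -poweR_EFin; apply: gt0_ler_poweR => //.
- by rewrite in_itv/= leey andbT diam_ge0.
- by rewrite in_itv/= leey andbT lee_fin.
- exact: diam_le.
Qed.

End Hausdorff.

(** * Dimension of the set carried by a tree of distinct words *)

Section Paths.
Variables (R : realType) (d N M : nat) (f : 'I_N -> 'rV[R]_d -> 'rV[R]_d).
Implicit Types (w : labelling N M) (xi : nat -> 'I_M).

Lemma lab_rcons w v a : lab w (rcons v a) = rcons (lab w v) (w (v, a)).
Proof. by rewrite -cats1 lab_cat cats1 /= /shift/= cats0. Qed.

Lemma lab_mkseq w xi q :
  lab w (mkseq xi q) = mkseq (fun k => w (mkseq xi k, xi k)) q.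
Proof. by elim: q => // q IH; rewrite !mkseqS lab_rcons IH. Qed.

Lemma random_subset_code w xi x :
  (fun q => foldr f 0 (lab w (mkseq xi q))) @ \oo --> x -> random_subset f w x.
Proof.
move=> h; exists (fun k => (mkseq xi k, xi k)).
  by split=> // k /=; rewrite mkseqS.
by under eq_fun do rewrite -lab_mkseq.
Qed.

End Paths.

Section TreeCoding.
Variables (R : realType) (d N M : nat) (f : 'I_N -> 'rV[R]_d -> 'rV[R]_d).
Variable r : 'I_N -> R.
Hypothesis hr : forall i, 0 < r i < 1.
Hypothesis hf : forall i, similarity (r i) (f i).
Hypothesis hO : open_set_condition f.
Variables (K : finType) (n : nat) (sigma : R) (Q : K -> seq 'I_N -> bool).
Hypothesis n0 : (0 < n)%N.
Hypothesis sigma01 : 0 < sigma < 1.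
Hypothesis Qratio : forall a x, Q a x -> sigma <= wratio r x.
Hypothesis Qinj : forall a b x, Q a x -> Q b x -> a = b.
(* [u] is the root of the tree of words, and [ch v a] is the path of [n] steps from
   its vertex [v] to the child of index [a]. *)
Variables (w : labelling N M) (u : seq 'I_M) (ch : seq 'I_M -> K -> n.-tuple 'I_M).
Variable j0 : 'I_M.

Definition vertex (ds : seq K) := foldl (fun v a => v ++ ch v a) u ds.

Hypothesis Qch : forall ds a, Q a (lab (shift (vertex ds) w) (ch (vertex ds) a)).

Definition word ds := lab w (vertex ds).

Lemma vertex_rcons ds a : vertex (rcons ds a) = vertex ds ++ ch (vertex ds) a.
Proof. by rewrite /vertex foldl_rcons. Qed.

Lemma word_rcons ds a :
  word (rcons ds a) = word ds ++ lab (shift (vertex ds) w) (ch (vertex ds) a).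
Proof. by rewrite /word vertex_rcons lab_cat. Qed.

Lemma size_vertex ds : size (vertex ds) = (size u + size ds * n)%N.
Proof.
elim/last_ind: ds => [|ds a IH]; first by rewrite addn0.
by rewrite vertex_rcons size_cat IH size_tuple size_rcons mulSn addnA addnAC.
Qed.

Lemma size_word ds : size (word ds) = (size u + size ds * n)%N.
Proof. by rewrite size_lab size_vertex. Qed.

Lemma word_ratio ds : wratio r (lab w u) * sigma ^+ size ds <= wratio r (word ds).
Proof.
elim/last_ind: ds => [|ds a IH]; first by rewrite expr0 mulr1.
rewrite size_rcons exprSr mulrA word_rcons wratio_cat; apply: ler_pM => //.
- by rewrite mulr_ge0 ?exprn_ge0 ?(ltW (wratio_gt0 hr _))//; case/andP: sigma01 => /ltW.
- by case/andP: sigma01 => /ltW.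
- exact: Qratio (Qch _ _).
Qed.

(** Nodes of one level have words of one length, and children of one node extend
    its word differently because [Q] determines the index of the child. *)
Lemma word_inj ds ds' : size ds = size ds' -> word ds = word ds' -> ds = ds'.
Proof.
elim/last_ind: ds ds' => [|ds a IH] ds'; first by case: ds'.
case/lastP: ds' => [|ds' a']; first by rewrite size_rcons.
rewrite !size_rcons => -[ss]; rewrite !word_rcons => /eqP.
rewrite eqseq_cat; last by rewrite !size_word ss.
move=> /andP[/eqP/(IH _ ss) e /eqP e']; subst ds'.
have := Qch ds a'; rewrite -e' => /(Qinj (Qch ds a)) -> //.
Qed.

Lemma vertex_prefix (dl : nat -> K) l l' : (l <= l')%N ->
  exists y, vertex (mkseq dl l') = vertex (mkseq dl l) ++ y.
Proof.
elim: l' => [|l' IH]; first by rewrite leqn0 => /eqP ->; exists [::]; rewrite cats0.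
rewrite leq_eqVlt => /predU1P[->|]; first by exists [::]; rewrite cats0.
rewrite ltnS => /IH[y hy]; rewrite mkseqS vertex_rcons hy -catA.
by eexists.
Qed.

(** The node of depth [k.+1] in the tree of words lies deeper than level [k], because
    [n > 0], so its vertex determines the step [k] of the path. *)
Definition path_of (dl : nat -> K) (k : nat) : 'I_M := nth j0 (vertex (mkseq dl k.+1)) k.

Lemma path_of_vertex dl l : mkseq (path_of dl) (size u + l * n) = vertex (mkseq dl l).
Proof.
apply: (@eq_from_nth _ j0).
  by rewrite size_mkseq size_vertex size_mkseq.
move=> k; rewrite size_mkseq => kl; rewrite nth_mkseq// /path_of.
have kk : (k < size (vertex (mkseq dl k.+1)))%N.
  rewrite size_vertex size_mkseq ltn_addl//; exact: leq_pmulr.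
have kl' : (k < size (vertex (mkseq dl l)))%N by rewrite size_vertex size_mkseq.
have [y1 e1] := vertex_prefix dl (leq_maxl l k.+1).
have [y2 e2] := vertex_prefix dl (leq_maxr l k.+1).
have := congr1 (nth j0 ^~ k) (etrans (esym e1) e2).
by rewrite !nth_cat kk kl' => ->.
Qed.

Variable pt : (nat -> K) -> 'rV[R]_d.
Hypothesis ptP : forall dl,
  (fun q => foldr f 0 (lab w (mkseq (path_of dl) q))) @ \oo --> pt dl.

(** The nodes of one level whose cylinders meet a set of diameter [D] are few.
    Each such node is extended along a path to a point of the set, until the ratio
    of the word drops to the order of [D]; the extensions stay incomparable, so
    their images of a reference point are separated, and they all lie within a
    multiple of [D] of each other. *)
Lemma few_nodes : exists c : nat, forall D l (C : set 'rV[R]_d) (J : {set l.-tuple K}),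
  0 < D < wratio r (lab w u) * sigma ^+ l ->
  (forall x y, C x -> C y -> enorm (x - y) <= D) ->
  (forall ds, ds \in J -> exists dl, mkseq dl l = ds /\ C (pt dl)) ->
  (#|J| <= c)%N.
Proof.
have [[a b] /= /andP[a0 ab] [b1 hab]] := ratio_bounds hr.
have [z [e e0 hsep]] := incomparable_separated hr hf hO.
have [R0 R00 hnear] := coded_point_near hr hf.
have C0 : 0 < R0 + enorm z + 1 by rewrite addr_gt0// ltr_wpDr// enorm_ge0.
have [c hc] := @separated_card_bound R d (e * a) _ (mulr_gt0 e0 a0) C0.
exists c => D l C J /andP[D0 Dl] CD hJ.
have [->|/set0Pn[ds0 ds0J]] := eqVneq J finset.set0; first by rewrite cards0.
have D1 : D < 1.
  apply: lt_le_trans Dl _; case/andP: sigma01 => s0 s1.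
  by rewrite mulr_ile1 ?exprn_ge0 ?exprn_ile1 ?(ltW (wratio_gt0 hr _)) ?wratio_le1 ?ltW.
pose om dl q := lab w (mkseq (path_of dl) q).
have omE dl q : om dl q = mkseq (fun k => w (mkseq (path_of dl) k, path_of dl k)) q.
  exact: lab_mkseq.
have som dl q : size (om dl q) = q by rewrite size_lab size_mkseq.
have omS dl q : om dl q.+1 = rcons (om dl q) (w (mkseq (path_of dl) q, path_of dl q)).
  by rewrite /om mkseqS lab_rcons.
have take_om dl q q' : (q <= q')%N -> take q (om dl q') = om dl q.
  by move=> qq; rewrite !omE /mkseq -map_take take_iota (minn_idPl qq).
have stop dl : exists q, a * D <= wratio r (om dl q) <= D /\
    forall q', (q' < q)%N -> D < wratio r (om dl q').
  have ex : exists q, wratio r (om dl q) <= D.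
    have : (fun q => b ^+ q) @ \oo --> (0 : R).
      by apply: cvg_expr; rewrite ger0_norm//; lra.
    move/cvgrPdist_lt => /(_ _ D0)[q _ hq]; exists q.
    have := hq q (leqnn q); rewrite sub0r normrN => /ltW h.
    apply: le_trans (le_trans (ler_norm _) h).
    have := @wratio_le _ _ _ hr b (om dl q); rewrite som; apply => i.
    by case/andP: (hab i).
  exists (ex_minn ex); case: ex_minnP => q qD qmin; split; last first.
    by move=> q' q'q; rewrite ltNge; apply/negP => /qmin; rewrite leqNgt q'q.
  rewrite qD andbT; case: q qD qmin => [|q] qD qmin.
    by move: qD; rewrite /om /wratio big_nil leNgt D1.
  rewrite omS wratio_rcons mulrC; apply: ler_pM; rewrite ?(ltW D0) ?(ltW a0)//.
    by rewrite leNgt; apply/negP => /ltW/qmin; rewrite ltnn.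
  by case/andP: (hab (w (mkseq (path_of dl) q, path_of dl q))).
have /choice[dlf hdl] : forall i : {ds : l.-tuple K | ds \in J}, exists dl,
   mkseq dl l = val (val i) /\ C (pt dl) by move=> [ds dsJ]; exact: hJ.
have /choice[qf hq] := fun i : {ds : l.-tuple K | ds \in J} => stop (dlf i).
pose y i := foldr f z (om (dlf i) (qf i)).
have ynear i : enorm (pt (dlf i) - y i) <= D * (R0 + enorm z).
  have cv : (fun q => foldr f 0 (mkseq (fun k => w (mkseq (path_of (dlf i)) k,
      path_of (dlf i) k)) q)) @ \oo --> pt (dlf i).
    by have := @ptP (dlf i); under eq_fun do rewrite lab_mkseq.
  have := hnear z _ _ (qf i) cv; rewrite -lab_mkseq -/(om _ _) => h.
  apply: le_trans h _.
  rewrite ler_wpM2r// ?addr_ge0 ?enorm_ge0 ?(ltW R00)//.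
  by have [/andP[_ ->]] := hq i.
pose i0 : {ds : l.-tuple K | ds \in J} := Sub ds0 ds0J.
rewrite -card_sig; apply: (hc D _ y (pt (dlf i0))) => //.
- move=> i; apply: le_trans (enorm_trans _ (pt (dlf i)) _) _.
  rewrite mulrDl mul1r mulrC lerD//; first by rewrite enormBC.
  by apply: CD; [have [] := hdl i|have [] := hdl i0].
- move=> i j ij.
  have lq k : (size u + l * n < qf k)%N.
    have [_ h] := hq k; rewrite ltnNge; apply/negP => qk.
    have [/andP[_ h2] _] := hq k.
    have := le_lt_trans h2 Dl; apply/negP; rewrite -leNgt.
    have [hk _] := hdl k.
    apply: (@le_trans _ _ (wratio r (om (dlf k) (size u + l * n)))).
      rewrite /om path_of_vertex -/(word _).
      by have := word_ratio (mkseq (dlf k) l); rewrite size_mkseq.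
    rewrite -(cat_take_drop (qf k) (om (dlf k) _)) wratio_cat take_om//.
    by rewrite ler_piMr ?(ltW (wratio_gt0 hr _))// wratio_le1.
  have pre k k' : prefix (om (dlf k) (qf k)) (om (dlf k') (qf k')) -> k = k'.
    move=> /prefixP[s hs]; apply: val_inj; apply: val_inj.
    have := congr1 (take (size u + l * n)) hs.
    rewrite takel_cat ?som ?(ltnW (lq k))// !take_om ?(ltnW (lq _))//.
    rewrite /om !path_of_vertex => /esym/word_inj; rewrite !size_mkseq => /(_ erefl).
    by have [-> _] := hdl k; have [-> _] := hdl k'.
  have inc : incomparable (om (dlf i) (qf i)) (om (dlf j) (qf j)).
    rewrite /incomparable; apply/andP; split; apply: contra ij => /pre ->//.
  apply: le_trans (hsep _ _ inc).
  rewrite -mulrA ler_pM2l//.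
  by have [/andP[-> _] _] := hq i.
Qed.

Hypothesis K1 : (1 < #|K|)%N.
Local Notation kap := #|K|.

Lemma kap_gt0 : (0 < #|K|)%N. Proof. exact: ltnW. Qed.

Definition digit (x : R) (k : nat) : K :=
  enum_val (Ordinal (ltn_pmod (Num.truncn (x * kap%:R ^+ k.+1)) kap_gt0)).

Lemma truncn_digit x k : 0 <= x ->
  Num.truncn (x * kap%:R ^+ k.+1) =
  (Num.truncn (x * kap%:R ^+ k) * kap + enum_rank (digit x k))%N.
Proof.
move=> x0; rewrite /digit enum_valK /=.
rewrite {1}(divn_eq (Num.truncn (x * kap%:R ^+ k.+1)) kap); congr (_ * _ + _)%N.
set m := Num.truncn _.
have kR : 0 < kap%:R :> R by rewrite ltr0n kap_gt0.
have /truncn_itv/andP[m1 m2] : 0 <= x * kap%:R ^+ k.+1 by rewrite mulr_ge0 ?exprn_ge0.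
rewrite -/m in m1 m2.
apply/esym/eqP; rewrite truncn_eq; last by rewrite mulr_ge0 ?exprn_ge0.
apply/andP; split.
  rewrite -(ler_pM2r kR) -mulrA -exprSr -natrM; apply: le_trans m1.
  by rewrite ler_nat leq_trunc_div.
rewrite -(ltr_pM2r kR) -mulrA -exprSr -natrM; apply: lt_le_trans m2 _.
by rewrite ler_nat; exact: ltn_ceil kap_gt0.
Qed.

Fixpoint digit_value (ds : seq K) (v : nat) : nat :=
  if ds is a :: ds' then digit_value ds' (v * kap + enum_rank a) else v.

Lemma digit_value_rcons ds a v :
  digit_value (rcons ds a) v = (digit_value ds v * kap + enum_rank a)%N.
Proof. by elim: ds v => //= b ds IH v; rewrite IH. Qed.

Lemma digit_valueE x l : 0 <= x < 1 ->
  digit_value (mkseq (digit x) l) 0 = Num.truncn (x * kap%:R ^+ l).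
Proof.
case/andP => x0 x1; elim: l => [|l IH].
  by rewrite expr0 mulr1/=; apply/esym/eqP; rewrite truncn_eq ?x0.
by rewrite mkseqS digit_value_rcons IH truncn_digit.
Qed.

Definition digit_itv l (ds : seq K) : set R :=
  `[(digit_value ds 0)%:R / kap%:R ^+ l, (digit_value ds 0).+1%:R / kap%:R ^+ l[%classic.

Lemma digit_itvP x l : 0 <= x < 1 -> digit_itv l (mkseq (digit x) l) x.
Proof.
move=> x01; rewrite /digit_itv/= in_itv/= digit_valueE//.
have kR : 0 < kap%:R ^+ l :> R by rewrite exprn_gt0// ltr0n kap_gt0.
rewrite ler_pdivrMr// ltr_pdivlMr//; apply: truncn_itv.
by rewrite mulr_ge0 ?(ltW kR)//; case/andP: x01.
Qed.

Lemma digit_itv_measure l ds : lebesgue_measure (digit_itv l ds) = (kap%:R ^- l)%:E.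
Proof.
have kR : 0 < kap%:R ^+ l :> R by rewrite exprn_gt0// ltr0n kap_gt0.
rewrite /digit_itv lebesgue_measure_itv/= lte_fin ltr_pM2r ?invr_gt0// ltr_nat ltnSn.
by rewrite -EFinD -mulrBl -[_.+1]addn1 natrD addrAC subrr add0r mul1r.
Qed.

(** Digits in base [#|K|] give every node of level [l] the mass [#|K| ^- l], at most
    [sigma ^+ l `^ s].  For a set of diameter [D] take the level where [sigma ^+ l]
    is of the order of [D]: the nodes that it meets are few. *)
Lemma coded_set_dim s : 0 < s -> 1 <= kap%:R * sigma `^ s ->
  forall s', 0 <= s' <= s -> hausdorff_measure s' (random_subset f w) <> 0%E.
Proof.
move=> s0 Ks; have [c hc] := few_nodes.
case/andP: (sigma01) => sg0 sg1.
set c0 := wratio r (lab w u) in hc.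
have c00 : 0 < c0 by exact: wratio_gt0.
have cs0 : 0 < c0 * sigma by rewrite mulr_gt0.
pose a : R := c.+1%:R * (c0 * sigma) `^ (- s).
have a0 : 0 < a by rewrite mulr_gt0 ?powR_gt0.
apply: (@mass_distribution R d _ (pt \o digit) a c0 s) => //.
  by move=> x _; apply: random_subset_code (@ptP (digit x)).
move=> C D /andP[D0 Dc0] CD.
have [l Dl1 Dl2] : exists2 l, D < c0 * sigma ^+ l & c0 * sigma ^+ l.+1 <= D.
  have ex : exists l, c0 * sigma ^+ l <= D.
    have : (fun q => sigma ^+ q) @ \oo --> (0 : R).
      by apply: cvg_expr; rewrite ger0_norm// ltW.
    move/cvgrPdist_lt => /(_ (D / c0)); rewrite divr_gt0// => /(_ isT)[q _ hq]; exists q.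
    have := hq q (leqnn q); rewrite sub0r normrN => /ltW h.
    rewrite mulrC -ler_pdivlMr//.
    exact: le_trans (ler_norm _) h.
  case: (ex_minnP ex) => -[|l] lD lmin.
    by move: lD; rewrite expr0 mulr1 leNgt Dc0.
  by exists l => //; rewrite ltNge; apply/negP => /lmin; rewrite ltnn.
pose J : {set l.-tuple K} :=
  [set ds : l.-tuple K | `[< exists2 x, 0 <= x < 1 &
     mkseq (digit x) l = ds /\ C (pt (digit x)) >]]%SET.
have cJ : (#|J| <= c)%N.
  apply: (hc D l C J) => //; first by rewrite D0.
  by move=> ds; rewrite inE => /asboolP[x _ hx]; exists (digit x).
exists (\big[setU/set0]_(ds in J) digit_itv l ds); split.
- by apply: bigsetU_measurable => ds _; exact: measurable_itv.
- move=> x x01 Cx; rewrite -bigcup_pred.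
  have sl : size (mkseq (digit x) l) == l by rewrite size_mkseq.
  exists (Tuple sl); last exact: digit_itvP.
  by rewrite /= inE; apply/asboolP; exists x.
apply: (@le_trans _ _ (\sum_(ds in J) (kap%:R ^- l)%:E)%E).
  pose P (A : set R) (x : \bar R) := measurable A /\ (lebesgue_measure A <= x)%E.
  suff [] : P (\big[setU/set0]_(ds in J) digit_itv l ds) (\sum_(ds in J) (kap%:R ^- l)%:E)%E by [].
  apply: (big_ind2 P).
  - by split=> //; rewrite measure0.
  - move=> A x B y [mA Ax] [mB By]; split; first exact: measurableU.
    apply: (@le_trans _ _ (lebesgue_measure A + lebesgue_measure B)%E).
      exact: measureU2.
    exact: leeD.
  - by move=> ds _; split; [exact: measurable_itv|rewrite digit_itv_measure].
rewrite sumEFin lee_fin sumr_const -[leLHS]mulr_natl /a -mulrA.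
apply: ler_pM => //; first by rewrite ler_nat ltnW.
have sl : sigma ^+ l <= D / (c0 * sigma).
  by rewrite ler_pdivlMr// mulrCA -exprSr.
have kR : 0 < kap%:R :> R by rewrite ltr0n kap_gt0.
apply: (@le_trans _ _ ((sigma `^ s) ^+ l)).
  rewrite -exprVn lerXn2r ?nnegrE ?invr_ge0 ?powR_ge0 ?(ltW kR)//.
  by rewrite -div1r ler_pdivrMr// mulrC.
rewrite powR_expr ?(ltW sg0)//.
apply: (@le_trans _ _ ((D / (c0 * sigma)) `^ s)).
  by rewrite ge0_ler_powR ?nnegrE ?exprn_ge0 ?divr_ge0 ?(ltW sg0) ?(ltW D0) ?(ltW cs0) ?(ltW s0).
have ci : 0 <= (c0 * sigma)^-1 by rewrite invr_ge0 ltW.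
rewrite (powRM _ (ltW D0) ci) mulrC -(powR_inv1 (ltW cs0)) -powRrM mulN1r.
exact: lexx.
Qed.

End TreeCoding.

(** The vertices at which trees of every depth start form an infinite tree by
    [good_branch]; choosing its paths puts it in the form studied above. *)
Lemma good_tree_dim (R : realType) (d N M : nat) (f : 'I_N -> 'rV[R]_d -> 'rV[R]_d)
    (r : 'I_N -> R) (K : finType) (n : nat) (sigma s : R) (Q : K -> seq 'I_N -> bool)
    (w : labelling N M) (j0 : 'I_M) :
  (forall i, 0 < r i < 1) -> (forall i, similarity (r i) (f i)) -> open_set_condition f ->
  (0 < n)%N -> 0 < sigma < 1 ->
  (forall a x, Q a x -> sigma <= wratio r x) ->
  (forall a b x, Q a x -> Q b x -> a = b) ->
  0 < s -> 1 <= #|K|%:R * sigma `^ s ->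
  (exists u, forall k, good n Q k (shift u w)) ->
  forall s', 0 <= s' <= s -> hausdorff_measure s' (random_subset f w) <> 0%E.
Proof.
move=> hr hf hO n0 sg Qr Qi s0 Ks [u gu].
have /choice[ch0 hch0] : forall va : seq 'I_M * K, exists y : n.-tuple 'I_M,
    (forall k, good n Q k (shift va.1 w)) ->
    Q va.2 (lab (shift va.1 w) y) /\ forall k, good n Q k (shift (va.1 ++ y) w).
  move=> [v a] /=; have [gv|gv] := pselect (forall k, good n Q k (shift v w)).
    by have [y [Qy gy]] := good_branch gv a; exists y => _; split => // k; rewrite shift_cat.
  by exists [tuple of nseq n j0] => /gv.
pose ch v a := ch0 (v, a).
have gV ds k : good n Q k (shift (vertex u ch ds) w).
  elim/last_ind: ds k => [//|ds a IH] k.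
  by rewrite vertex_rcons; have [_] := hch0 (vertex u ch ds, a) IH; exact.
have Qch ds a : Q a (lab (shift (vertex u ch ds) w) (ch (vertex u ch ds) a)).
  by have [] := hch0 (vertex u ch ds, a) (gV ds).
have K1 : (1 < #|K|)%N.
  rewrite -(ltr_nat R); apply: (le_lt_trans Ks); case/andP: sg => sg0 sg1.
  have K0 : (0 < #|K|)%N.
    by rewrite lt0n; apply/eqP => K0; move: Ks; rewrite K0 mul0r ler10.
  rewrite -[ltRHS]mulr1 ltr_pM2l ?ltr0n//.
  have : ln sigma < 0 by rewrite ln_lt0// sg0.
  by move=> h; rewrite /powR gt_eqF// expR_lt1 pmulr_rlt0.
have /choice[pt hpt] : forall dl, exists x : 'rV[R]_d,
    (fun q => foldr f 0 (lab w (mkseq (path_of u ch j0 dl) q))) @ \oo --> x.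
  move=> dl; under eq_exists => x do under eq_fun do rewrite lab_mkseq.
  exact: coded_point.
exact: (coded_set_dim hr hf hO n0 sg Qr Qi Qch hpt K1 s0 Ks).
Qed.

(** * Covers by the words that occur *)

Section UpperBound.
Variables (R : realType) (d N M : nat) (f : 'I_N -> 'rV[R]_d -> 'rV[R]_d).
Variables (p r : 'I_N -> R).
Hypothesis p1 : \sum_i p i = 1.
Hypothesis p0 : forall i, 0 < p i.
Hypothesis hr : forall i, 0 < r i < 1.
Hypothesis hf : forall i, similarity (r i) (f i).
Variables (disp : measure_display) (T : measurableType disp) (Pr : probability T R).
Variable omega : edge M -> T -> 'I_N.
Hypothesis homega : iid_labels Pr p omega.
Variable w0 : labelling N M.
Hypothesis M0 : (0 < M)%N.
Local Notation prob := (prob Pr omega).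

Fixpoint words (n : nat) : seq (seq 'I_N) :=
  if n is n'.+1 then [seq i :: x | i <- enum 'I_N, x <- words n'] else [:: [::]].

Lemma mem_words n x : (x \in words n) = (size x == n).
Proof.
elim: n x => [|n IH] [|i x] //=.
  by apply/negbTE/negP => /allpairsP[[j y] [_ _]].
rewrite eqSS -IH; apply/allpairsP/idP => [[[j y] [_ yw [_ ->]]] //|xw].
by exists (i, x); rewrite mem_enum.
Qed.

Lemma sum_words (g : 'I_N -> R) n :
  \sum_(x <- words n) \prod_(i <- x) g i = (\sum_i g i) ^+ n.
Proof.
elim: n => [|n IH] /=; first by rewrite big_seq1 big_nil.
rewrite big_allpairs_dep exprS big_enum/= big_distrl/=; apply: eq_bigr => i _.
by rewrite -IH big_distrr/=; apply: eq_bigr => x _; rewrite big_cons.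
Qed.

Definition occurs n (x : seq 'I_N) (w : labelling N M) :=
  [exists u : n.-tuple 'I_M, lab w u == x].

Lemma finite_event_occurs n x : finite_event (occurs n x).
Proof. by apply: finite_event_exists => u; exact: (finite_event_lab u (eq_op^~ x)). Qed.

(** The probability of occurring is at most 1 and at most the expected number of
    occurrences, hence at most any interpolation between the two. *)
Lemma prob_occurs n x t : size x = n -> 0 <= t <= 1 ->
  prob (occurs n x) <= (M%:R ^+ n * wratio p x) `^ t.
Proof.
move=> sx /andP[t0 t1].
have px0 : 0 < wratio p x by apply: prodr_gt0.
set c := _ * _; have c0 : 0 < c by rewrite mulr_gt0// exprn_gt0// ltr0n.
have h1 : prob (occurs n x) <= 1 by exact: (prob_le1 p1 homega w0 (finite_event_occurs n x)).
have h2 : prob (occurs n x) <= c.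
  apply: le_trans (prob_exists_le p0 homega w0 _) _.
    by move=> u; exact: (finite_event_lab u (eq_op^~ x)).
  under eq_bigr => u _ do rewrite (prob_lab p1 homega w0) ?size_tuple//.
  by rewrite sumr_const card_tuple card_ord -mulr_natl natrX.
have [c1|c1] := leP c 1.
  apply: le_trans h2 _; rewrite -{1}(powRr1 (ltW c0)).
  by apply: ger_powR => //; rewrite c0.
by apply: le_trans h1 _; rewrite -(powRr0 c) ler_powR// ltW.
Qed.

Definition cover_weight s n (w : labelling N M) : R :=
  \sum_(x <- words n) wratio r x `^ s * (occurs n x w)%:R.

Lemma prob_cover_weight s t n (e : R) : 0 <= t <= 1 -> 0 < e ->
  finite_event (fun w => e <= cover_weight s n w) /\
  prob (fun w => e <= cover_weight s n w) <=
    (\sum_i r i `^ s * (M%:R * p i) `^ t) ^+ n / e.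
Proof.
move=> t01 e0.
have [S dS] : exists S, forall x, x \in words n -> depends S (occurs n x).
  have /choice[S hS] := finite_event_occurs n.
  exists (flatten [seq S x | x <- words n]) => x xw; apply: depends_sub (hS x) => y yS.
  by apply/flattenP; exists (S x) => //; exact: map_f.
have dE : depends S (fun w => e <= cover_weight s n w).
  move=> w w' h; congr (_ <= _); apply: eq_big_seq => x xw.
  by rewrite (dS x xw _ _ h).
split; first by exists S.
rewrite ler_pdivlMr// (prob_Ex homega w0 dE) mulrC -ExZ.
apply: (@le_trans _ _ (Ex p (undup S) (cover_weight s n) w0)).
  apply: Ex_le => [i|w]; first exact: ltW.
  case: (leP e (cover_weight s n w)) => h; first by rewrite mulr1n mulr1.
  rewrite mulr0n mulr0.
  by apply: sumr_ge0 => x _; rewrite mulr_ge0 ?powR_ge0.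
rewrite /cover_weight Ex_sum -sum_words !big_seq.
apply: ler_sum => x xw; rewrite ExZ -(prob_Ex homega w0 (dS x xw)).
have sx : size x = n by apply/eqP; rewrite -mem_words.
apply: (@le_trans _ _ (wratio r x `^ s * (M%:R ^+ n * wratio p x) `^ t)).
  by rewrite ler_wpM2l ?powR_ge0// prob_occurs.
rewrite big_split/= -prodr_powR => [|i]; last by case/andP: (hr i) => /ltW.
rewrite ler_wpM2l ?prodr_ge0// => [i _|]; first exact: powR_ge0.
rewrite prodr_powR => [|i]; last by rewrite mulr_ge0// ltW.
by rewrite big_split/= big_const_seq count_predT iter_mulr_1 sx.
Qed.

Lemma random_subset_near w : exists2 R0 : R, 0 < R0 & forall y n,
  random_subset f w y -> exists2 x, size x = n /\ occurs n x w &
    enorm (y - foldr f 0 x) <= wratio r x * R0.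
Proof.
have [R0 R00 h] := coded_point_near hr hf; exists R0 => // y n [P [P0 PS] yP].
pose xi k := (P k).2.
have PE k : P k = (mkseq xi k, xi k).
  rewrite [LHS]surjective_pairing; congr pair.
  by elim: k => [|k IH]; rewrite ?P0// PS IH mkseqS.
exists (mkseq (fun k => w (P k)) n).
  rewrite size_mkseq; split => //.
  have sx : size (mkseq xi n) == n by rewrite size_mkseq.
  apply/existsP; exists (Tuple sx); rewrite /= lab_mkseq; apply/eqP.
  by apply: eq_mkseq => k; rewrite -PE.
by have := h 0 _ _ n yP; rewrite enorm0 addr0.
Qed.

Lemma cover_weight_dim s w : 0 <= s ->
  (forall m n0, exists2 n, (n0 <= n)%N & cover_weight s n w < m.+1%:R^-1) ->
  hausdorff_measure s (random_subset f w) = 0%E.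
Proof.
move=> s0 hw; apply: hausdorff_measure_eq0 => // delta e delta0 e0.
have [R0 R00 hR0] := random_subset_near w.
have [[a b] /= /andP[a0 ab] [b1 hab]] := ratio_bounds hr.
pose c := 2 * R0; have c0 : 0 < c by rewrite mulr_gt0.
have [n0 hn0] : exists n0, forall n, (n0 <= n)%N -> c * b ^+ n <= delta.
  have : (fun q => b ^+ q) @ \oo --> (0 : R).
    by apply: cvg_expr; rewrite ger0_norm//; lra.
  move/cvgrPdist_lt => /(_ (delta / c)); rewrite divr_gt0// => /(_ isT)[q _ hq].
  exists q => n qn; have := hq n qn; rewrite sub0r normrN => /ltW h.
  by rewrite mulrC -ler_pdivlMr//; exact: le_trans (ler_norm _) h.
pose m := Num.truncn (c `^ s / e).
have [n nn0 hn] := hw m n0.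
pose ball x : set 'rV[R]_d * R :=
  ([set y | enorm (y - foldr f 0 x) <= wratio r x * R0], c * wratio r x).
exists [seq ball x | x <- words n & occurs n x w].
  move=> C /mapP[x + ->] /=; rewrite mem_filter mem_words => /andP[_ /eqP sx].
  rewrite mulr_ge0 ?(ltW c0) ?(ltW (wratio_gt0 hr _))//=; split.
    apply: le_trans (hn0 n nn0); rewrite ler_pM2l//.
    have := @wratio_le _ _ _ hr b x; rewrite sx; apply => i.
    by case/andP: (hab i).
  move=> y y' hy hy'; apply: le_trans (enorm_trans _ (foldr f 0 x) _) _.
  rewrite [X in _ + X]enormBC; apply: le_trans (lerD hy hy') _.
  by rewrite /c; lra.
split.
  move=> y /hR0 => /(_ n)[x [sx ox] hx]; exists (ball x) => //.
  by apply/mapP; exists x => //; rewrite mem_filter ox mem_words sx eqxx.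
rewrite big_map big_filter big_mkcond/=.
apply: (@le_trans _ _ (c `^ s * cover_weight s n w)).
  rewrite /cover_weight mulr_sumr; apply: ler_sum => x _.
  case: ifP => _; last by rewrite mulr0n !mulr0.
  by rewrite mulr1n mulr1 powRM ?(ltW c0) ?(ltW (wratio_gt0 hr _)).
apply: (@le_trans _ _ (c `^ s * m.+1%:R^-1)); first by rewrite ler_wpM2l ?powR_ge0// ltW.
rewrite ler_pdivrMr// mulrC -ler_pdivrMr//; apply: ltW; exact: truncnS_gt.
Qed.

(** The expected weight of the cover by the words of length [n] tends to 0, so by
    Markov's inequality the weights are almost surely not bounded below from any
    rank on; this is enough because every length gives a cover. *)
Lemma measure_eq0_ae s t : 0 <= s -> 0 <= t <= 1 ->
  \sum_i r i `^ s * (M%:R * p i) `^ t < 1 ->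
  {ae Pr, forall w, hausdorff_measure s (random_subset f (labels omega w)) = 0%E}.
Proof.
move=> s0 t01; set th := \sum_i _ => th1.
have th0 : 0 <= th by apply: sumr_ge0 => i _; rewrite mulr_ge0 ?powR_ge0.
suff : {ae Pr, forall w, forall m n0, exists2 n, (n0 <= n)%N &
    cover_weight s n (labels omega w) < m.+1%:R^-1}.
  by apply: filterS => w hw; exact: cover_weight_dim.
apply/ae_foralln => m; apply/ae_foralln => n0.
have m0 : 0 < m.+1%:R^-1 :> R by rewrite invr_gt0.
pose B n := event omega (fun w => m.+1%:R^-1 <= cover_weight s (n0 + n) w).
have fB n := (prob_cover_weight s (n0 + n) t01 m0).1.
have PB n := (prob_cover_weight s (n0 + n) t01 m0).2.
have mB n : measurable (B n) by exact: (measurable_event homega w0 (fB n)).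
have mall : measurable (\bigcap_n B n) by apply: bigcap_measurable => //; exists 0%N.
exists (\bigcap_n B n); split => //.
  apply/eqP; rewrite eq_le measure_ge0 andbT; apply/lee_addgt0Pr => e e0.
  rewrite add0e.
  have : (fun q => th ^+ q) @ \oo --> (0 : R).
    by apply: cvg_expr; rewrite ger0_norm.
  move/cvgrPdist_lt => /(_ (e * m.+1%:R^-1)); rewrite mulr_gt0// => /(_ isT)[q _ hq].
  have {}hq := hq (n0 + q)%N (leq_addl n0 q).
  apply: (@le_trans _ _ (Pr (B q))).
    by apply: le_measure; rewrite ?inE//; exact: bigcap_inf.
  rewrite (probE homega w0 (fB q)) lee_fin; apply: le_trans (PB q) _.
  rewrite ler_pdivrMr//; move: hq; rewrite sub0r normrN => /ltW.
  exact/le_trans/ler_norm.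
move=> w /= h n _; rewrite /B /event/= leNgt; apply/negP => lt; apply: h.
by exists (n0 + n)%N => //; exact: leq_addr.
Qed.

End UpperBound.

(** * The pressure function *)

Section Pressure.
Variables (R : realType) (N : nat) (r : 'I_N -> R).
Hypothesis hr : forall i, 0 < r i < 1.
Implicit Types (c x : 'I_N -> R) (s t : R).

Let r0 i : 0 < r i. Proof. by case/andP: (hr i). Qed.

Lemma powR_sub (a s s' : R) : 0 < a -> a `^ s' = a `^ s * expR ((s' - s) * ln a).
Proof.
by move=> a0; rewrite /powR !gt_eqF// -expRD -mulrDl addrC subrK.
Qed.

Lemma sum_powR_lt c s s' : (0 < N)%N -> (forall i, 0 < c i) -> s < s' ->
  \sum_i c i * r i `^ s' < \sum_i c i * r i `^ s.
Proof.
move=> N0 c0 ss; apply: ltr_sum => [|i _]; first by apply/hasP; exists (Ordinal N0).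
rewrite ltr_pM2l// (powR_sub s s')// gtr_pMr ?powR_gt0// expR_lt1 pmulr_rlt0 ?subr_gt0//.
by rewrite ln_lt0.
Qed.

Lemma sum_powR_inj c s s' : (0 < N)%N -> (forall i, 0 < c i) ->
  \sum_i c i * r i `^ s = \sum_i c i * r i `^ s' -> s = s'.
Proof.
move=> N0 c0 e; have [h|h|//] := ltgtP s s'; have := sum_powR_lt N0 c0 h;
  by rewrite e ltxx.
Qed.

Lemma continuous_sum_powR (V : topologicalType) (c : 'I_N -> R) (b : 'I_N -> V -> R) v :
  (forall i, {for v, continuous (b i)}) ->
  {for v, continuous (fun v => \sum_i c i * expR (b i v))}.
Proof.
move=> bc; apply: cvg_big => [|i _]; first exact: add_continuous.
apply: cvgMr; apply: (@continuous_comp _ _ _ (b i) expR); first exact: bc.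
exact: continuous_expR.
Qed.

Lemma sum_powR_root c (y : R) : (0 < N)%N -> (forall i, 0 < c i) -> 0 < y ->
  exists! s, \sum_i c i * r i `^ s = y.
Proof.
move=> N0 c0 y0.
suff [s hs] : exists s, \sum_i c i * r i `^ s = y.
  by exists s; split=> // s' hs'; apply: (sum_powR_inj N0 c0); rewrite hs.
have [[a b] /= /andP[a0 ab] [b1 hab]] := ratio_bounds hr.
have b0 : 0 < b by exact: lt_le_trans ab.
pose i0 := Ordinal N0.
have C0 : 0 < \sum_i c i.
  rewrite (bigD1 i0)//= ltr_pwDl// sumr_ge0// => i _; exact: ltW.
pose e := Num.min (y / \sum_i c i) (c i0 / y).
have e0 : 0 < e by rewrite lt_min !divr_gt0.
have [n hn] : exists n, b ^+ n <= e.
  have : (fun q => b ^+ q) @ \oo --> (0 : R).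
    by apply: cvg_expr; rewrite ger0_norm// ltW.
  move/cvgrPdist_lt => /(_ _ e0)[q _ hq]; exists q.
  by have := hq q (leqnn q); rewrite sub0r normrN => /ltW/(le_trans (ler_norm _)).
pose g s := \sum_i c i * r i `^ s.
have gE : g = fun s => \sum_i c i * expR (s * ln (r i)).
  by apply/funext => s; apply: eq_bigr => i _; rewrite /powR gt_eqF.
have gc : continuous g.
  rewrite gE => s; apply: continuous_sum_powR => i; apply: cvgMl; exact: cvg_id.
have rn i : r i ^+ n <= b ^+ n.
  by rewrite lerXn2r ?nnegrE ?(ltW (r0 i)) ?(ltW b0)//; case/andP: (hab i).
have hi : g n%:R <= y.
  apply: (@le_trans _ _ (\sum_i c i * e)).
    apply: ler_sum => i _; rewrite ler_wpM2l ?(ltW (c0 i))// powR_mulrn ?(ltW (r0 i))//.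
    exact: le_trans (rn i) hn.
  by rewrite -mulr_suml mulrC -ler_pdivlMr// ge_min lexx.
have lo : y <= g (- n%:R).
  apply: (@le_trans _ _ (c i0 * r i0 `^ (- n%:R))); last first.
    by rewrite /g (bigD1 i0)//= lerDl sumr_ge0// => i _; rewrite mulr_ge0 ?powR_ge0 ?ltW.
  rewrite powRN powR_mulrn ?(ltW (r0 i0))// ler_pdivlMr ?exprn_gt0// mulrC -ler_pdivlMr//.
  by apply: le_trans (rn i0) (le_trans hn _); rewrite ge_min lexx orbT.
have nn : - n%:R <= n%:R :> R by rewrite ge0_cp.
have [||s _ hs] := @IVT R g (- n%:R) n%:R y nn.
- by apply: continuous_subspaceT.
- by rewrite ge_min hi orbT le_max lo.
by exists s.
Qed.

Variable x : 'I_N -> R.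
Hypothesis x0 : forall i, 0 < x i.

Definition pressure s t := \sum_i r i `^ s * x i `^ t.
Definition pressure_ds s t := \sum_i r i `^ s * x i `^ t * ln (r i).
Definition pressure_dt s t := \sum_i r i `^ s * x i `^ t * ln (x i).

Lemma pressure_ds_lt0 s t : (0 < N)%N -> pressure_ds s t < 0.
Proof.
move=> N0; rewrite /pressure_ds -oppr_gt0 -sumrN (bigD1 (Ordinal N0))//=.
have h i : 0 < - (r i `^ s * x i `^ t * ln (r i)).
  by rewrite oppr_gt0 pmulr_rlt0 ?ln_lt0// mulr_gt0 ?powR_gt0.
by rewrite ltr_pwDl// sumr_ge0// => i _; exact: ltW.
Qed.

(** The pressure is a sum of exponentials of linear forms: it lies above its
    tangent planes, and touches one at another point only when every linear form
    agrees at the two points. *)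
Lemma pressure_tangent s t s' t' :
  pressure s t + (s' - s) * pressure_ds s t + (t' - t) * pressure_dt s t
    <= pressure s' t' ?= iff [forall i, (s' - s) * ln (r i) + (t' - t) * ln (x i) == 0].
Proof.
pose z i := (s' - s) * ln (r i) + (t' - t) * ln (x i).
have pE : pressure s' t' = \sum_i r i `^ s * x i `^ t * expR (z i).
  apply: eq_bigr => i _; rewrite (powR_sub s s')// (powR_sub t t')// /z expRD.
  ring.
have -> : pressure s t + (s' - s) * pressure_ds s t + (t' - t) * pressure_dt s t =
    \sum_i r i `^ s * x i `^ t * (1 + z i).
  rewrite /pressure /pressure_ds /pressure_dt !mulr_sumr -!big_split/=.
  by apply: eq_bigr => i _; rewrite /z; ring.
rewrite pE; apply: leif_sum => i _; rewrite mono_leif; last first.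
  by move=> u v; rewrite ler_pM2l// mulr_gt0 ?powR_gt0.
split; first exact: expR_ge1Dx.
apply/eqP/eqP => [|zi]; last by rewrite /z zi expR0 addr0.
by move=> e; apply/eqP; apply: contraT => /expR_gt1Dx; rewrite e ltxx.
Qed.

Lemma pressure_tangent_le s t s' t' : pressure s t = pressure s' t' ->
  (s' - s) * pressure_ds s t + (t' - t) * pressure_dt s t <= 0.
Proof.
move=> e; have := (pressure_tangent s t s' t').1; rewrite -e; lra.
Qed.

(** Along a level curve of the pressure, [s] is a Lipschitz function of [t]:
    compare the tangent planes at the two points. *)
Lemma level_lipschitz : (0 < N)%N -> exists2 k : R, 0 < k & forall s t s' t',
  pressure s t = pressure s' t' -> `|s' - s| <= k * `|t' - t|.
Proof.
move=> N0.
have [[a b] /= /andP[a0 ab] [b1 hab]] := ratio_bounds hr.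
have b0 : 0 < b by exact: lt_le_trans ab.
pose X := \sum_i `|ln (x i)|.
have X0 : 0 <= X by apply: sumr_ge0.
have lb : 0 < - ln b by rewrite oppr_gt0 ln_lt0// b0.
have one s t s' t' : pressure s t = pressure s' t' -> - (s' - s) <= (X / - ln b) * `|t' - t|.
  move=> e; have h := pressure_tangent_le e.
  have P0 : 0 < pressure s t.
    rewrite /pressure (bigD1 (Ordinal N0))//= ltr_pwDl ?mulr_gt0 ?powR_gt0//.
    by apply: sumr_ge0 => i _; rewrite mulr_ge0 ?powR_ge0.
  have h1 : - ln b * pressure s t <= - pressure_ds s t.
    rewrite /pressure /pressure_ds mulr_sumr -sumrN; apply: ler_sum => i _.
    rewrite mulrC -mulrN ler_pM2l ?mulr_gt0 ?powR_gt0// lerN2 ler_ln ?posrE//.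
    by case/andP: (hab i).
  have h2 : `|pressure_dt s t| <= X * pressure s t.
    apply: le_trans (ler_norm_sum _ _ _) _; rewrite /pressure mulr_sumr.
    apply: ler_sum => i _; rewrite normrM mulrC (ger0_norm (mulr_ge0 (powR_ge0 _ _) (powR_ge0 _ _))).
    rewrite ler_wpM2r ?mulr_ge0 ?powR_ge0// /X (bigD1 i)//= lerDl.
    exact: sumr_ge0.
  rewrite leNgt; apply/negP => lt.
  have ss : 0 < - (s' - s).
    by apply: le_lt_trans lt; rewrite mulr_ge0// divr_ge0// ltW.
  move: lt; rewrite mulrAC ltr_pdivrMr//; apply/negP; rewrite -leNgt.
  rewrite -(ler_pM2r P0).
  apply: (@le_trans _ _ (- (s' - s) * - pressure_ds s t)).
    by rewrite -mulrA ler_pM2l.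
  apply: (@le_trans _ _ (`|t' - t| * `|pressure_dt s t|)); last first.
    by rewrite [X in _ <= X]mulrAC [X in _ <= X]mulrC ler_wpM2l.
  rewrite -normrM -normrN; apply: le_trans (ler_norm _).
  by rewrite mulrNN; lra.
exists (X / - ln b + 1) => [|s t s' t' e]; first by rewrite ltr_wpDl// divr_ge0// ltW.
have h1 := one _ _ _ _ e; have h2 := one _ _ _ _ (esym e).
rewrite opprB in h1; rewrite opprB distrC in h2.
have h : `|s' - s| <= X / - ln b * `|t' - t| by rewrite ler_norml; lra.
by rewrite mulrDl mul1r (le_trans h)// lerDl.
Qed.

(** The intermediate value theorem for the [t]-derivative along the level curve,
    which is continuous by [level_lipschitz]. *)
Lemma critical_exists : (0 < N)%N ->
  (forall s, pressure s 0 = 1 -> pressure_dt s 0 < 0) ->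
  (forall s, pressure s 1 = 1 -> 0 < pressure_dt s 1) ->
  exists s t, pressure s t = 1 /\ pressure_dt s t = 0.
Proof.
move=> N0 h0 h1.
have /choice[sg hsg] : forall t, exists s, pressure s t = 1.
  move=> t; have [|s [hs _]] := @sum_powR_root (fun i => x i `^ t) 1 N0 _ ltr01.
    by move=> i; exact: powR_gt0.
  by exists s; rewrite -hs; apply: eq_bigr => i _; rewrite mulrC.
have [k k0 hk] := level_lipschitz N0.
have sgc : continuous sg.
  move=> t; apply/cvgrPdist_le => e e0.
  near=> t'.
  apply: le_trans (hk (sg t') t' (sg t) t _) _; first by rewrite !hsg.
  rewrite mulrC -ler_pdivlMr//; near: t'.
  by have /cvgrPdist_le := @cvg_id _ (nbhs t); apply; rewrite divr_gt0.
pose D t := pressure_dt (sg t) t.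
have DE : D = fun t => \sum_i ln (x i) * expR (sg t * ln (r i) + t * ln (x i)).
  apply/funext => t; apply: eq_bigr => i _.
  by rewrite mulrC expRD /powR !gt_eqF.
have Dc : continuous D.
  rewrite DE => t; apply: continuous_sum_powR => i.
  by apply: cvgD; apply: cvgMl; [exact: sgc|exact: cvg_id].
have [||t _ ht] := @IVT R D 0 1 0 ler01.
- exact: continuous_subspaceT.
- have a0 : D 0 < 0 by apply: h0; exact: hsg.
  have a1 : 0 < D 1 by apply: h1; exact: hsg.
  by rewrite ge_min (ltW a0) le_max (ltW a1) orbT.
by exists (sg t), t.
Unshelve. all: by end_near. Qed.

(** The tangent planes at two critical points do not vary with [t], so each point
    has the smaller [s]; strict convexity in [t] then separates them unless they
    coincide. *)
Lemma critical_unique s t s' t' : (0 < N)%N -> (exists i, x i != 1) ->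
  pressure s t = 1 -> pressure_dt s t = 0 ->
  pressure s' t' = 1 -> pressure_dt s' t' = 0 -> (s, t) = (s', t').
Proof.
move=> N0 [i xi] p1 d1 p2 d2.
have e1 : s' - s >= 0.
  have := @pressure_tangent_le s t s' t'; rewrite p1 p2 d1 mulr0 addr0 => /(_ erefl).
  by rewrite nmulr_lle0// pressure_ds_lt0.
have e2 : s - s' >= 0.
  have := @pressure_tangent_le s' t' s t; rewrite p1 p2 d2 mulr0 addr0 => /(_ erefl).
  by rewrite nmulr_lle0// pressure_ds_lt0.
have es : s' = s by lra.
subst s'; congr pair.
have := (pressure_tangent s t s t').2; rewrite p1 p2 d1 subrr mul0r mulr0 !addr0 eqxx.
move=> /esym/forallP/(_ i); rewrite mul0r add0r mulf_eq0 ln_eq0// (negbTE xi) orbF.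
by rewrite subr_eq0 => /eqP.
Qed.

End Pressure.

(** * The dimension of the random subset *)

(** The lower exponents are multiples of [s], and not [s] minus something, so that
    they stay positive. *)
Lemma hausdorff_dim_eq (R : realType) (d : nat) (F : set 'rV[R]_d) (s : R) : 0 < s ->
  (forall k : nat, hausdorff_measure (s + k.+1%:R^-1) F = 0%E) ->
  (forall k s', 0 <= s' <= s * (1 - k.+2%:R^-1) -> hausdorff_measure s' F <> 0%E) ->
  hausdorff_dim F = s%:E.
Proof.
move=> s0 up lo; apply/eqP; rewrite eq_le; apply/andP; split; apply/lee_addgt0Pr => e e0.
  pose k := Num.truncn e^-1.
  apply: le_trans (hausdorff_dim_le _ (up k)) _; first by rewrite addr_ge0 ?ltW.
  rewrite lee_fin lerD2l -[leRHS]invrK lef_pV2 ?posrE ?invr_gt0//.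
  by apply: ltW; exact: truncnS_gt.
pose k := Num.truncn (s / e).
have := leeD2r e%:E (hausdorff_dim_ge (lo k)).
apply: le_trans; rewrite -EFinD lee_fin mulrBr mulr1 -addrA lerDl addrC subr_ge0.
rewrite ler_pdivrMr// mulrC -ler_pdivrMr//.
apply: le_trans (ltW (truncnS_gt (s / e))) _; by rewrite ler_nat.
Qed.

Section RandomDimension.
Variables (R : realType) (d N M : nat) (f : 'I_N -> 'rV[R]_d -> 'rV[R]_d).
Variables (p r : 'I_N -> R).
Hypothesis hN : (0 < N)%N.
Hypothesis hM : (2 <= M)%N.
Hypothesis p1 : \sum_i p i = 1.
Hypothesis p0 : forall i, 0 < p i.
Hypothesis hr : forall i, 0 < r i < 1.
Hypothesis hf : forall i, similarity (r i) (f i).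
Hypothesis hO : open_set_condition f.
Variables (disp : measure_display) (T : measurableType disp) (Pr : probability T R).
Variable omega : edge M -> T -> 'I_N.
Hypothesis homega : iid_labels Pr p omega.

(** The three cases of the dimension formula at once: [s] is the value at [t] of
    the level curve [pressure s t = 1], and the condition on the derivative says
    that this curve is minimal over [0, 1] at [t], be it inside or at an end. *)
Lemma random_dim_ae (s t : R) :
  0 < s -> 0 <= t <= 1 ->
  pressure r (fun i => M%:R * p i) s t = 1 ->
  t * pressure_dt r (fun i => M%:R * p i) s t <= 0
    <= (1 - t) * pressure_dt r (fun i => M%:R * p i) s t ->
  {ae Pr, forall w, hausdorff_dim (random_subset f (fun e => omega e w)) = s%:E}.
Proof.
set x := fun i => M%:R * p i => s0 t01 ps /andP[dt0 dt1].
have MR : 0 < M%:R :> R by rewrite ltr0n ltnW.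
have M0 : (0 < M)%N by exact: ltnW.
have r0 i : 0 < r i by case/andP: (hr i).
have x0 i : 0 < x i by rewrite mulr_gt0.
pose w0 : labelling N M := fun=> Ordinal hN.
have up : {ae Pr, forall w, forall k : nat,
    hausdorff_measure (s + k.+1%:R^-1) (random_subset f (labels omega w)) = 0%E}.
  apply/ae_foralln => k; apply: (measure_eq0_ae p1 p0 hr hf homega w0 M0 _ t01).
    by rewrite addr_ge0// ltW.
  rewrite -[ltRHS]ps /pressure.
  under eq_bigr do rewrite mulrC; under [ltRHS]eq_bigr do rewrite mulrC.
  apply: (@sum_powR_lt _ _ _ hr (fun i => x i `^ t) _ _ hN) => [i|].
    by rewrite powR_gt0.
  by rewrite ltrDl invr_gt0.
pose q i := r i `^ s * x i `^ t.
have q0 i : 0 < q i by rewrite mulr_gt0 ?powR_gt0.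
have lnq i : ln (q i) = s * ln (r i) + t * ln (x i).
  by rewrite lnM ?posrE ?powR_gt0// !ln_powR.
have dsN := pressure_ds_lt0 hr x0 s t hN.
have lo : {ae Pr, forall w, forall k : nat, forall s', 0 <= s' <= s * (1 - k.+2%:R^-1) ->
    hausdorff_measure s' (random_subset f (labels omega w)) <> 0%E}.
  apply/ae_foralln => k; set sk := s * _.
  have k2 : k.+2%:R^-1 < 1 :> R by rewrite invf_lt1 ?ltr1n.
  have sk0 : 0 < sk by rewrite mulr_gt0// subr_gt0.
  have sks : sk < s.
    by rewrite -[ltRHS]mulr1 ltr_pM2l// ltrBlDr ltrDl invr_gt0.
  have dsk : 0 < (sk - s) * pressure_ds r x s t by rewrite nmulr_lgt0// subr_lt0.
  have [||K [n [sg [Q [[n0 sg01] hQ Qi Ks ae]]]]] :=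
      word_tree_ae p1 p0 hr homega w0 hM q0 ps sk0.
  - have -> : \sum_i q i * ln (r i `^ sk / q i) =
        (sk - s) * pressure_ds r x s t - t * pressure_dt r x s t.
      rewrite /pressure_ds /pressure_dt !mulr_sumr -sumrB; apply: eq_bigr => i _.
      rewrite -/(q i) lnM ?posrE ?powR_gt0 ?invr_gt0// lnV ?posrE// lnq ln_powR.
      by ring.
    by lra.
  - have -> : \sum_i q i * ln (r i `^ sk * (M%:R * p i) / q i) =
        (sk - s) * pressure_ds r x s t + (1 - t) * pressure_dt r x s t.
      rewrite /pressure_ds /pressure_dt !mulr_sumr -big_split/=; apply: eq_bigr => i _.
      rewrite -/(q i) -/(x i) lnM ?posrE ?mulr_gt0 ?powR_gt0 ?invr_gt0//.
      rewrite lnM ?posrE ?powR_gt0// lnV ?posrE// lnq ln_powR.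
      by ring.
    by lra.
  apply: filterS ae => w hw s' s'01.
  apply: (good_tree_dim (Ordinal M0) hr hf hO n0 sg01 _ Qi sk0 Ks hw s'01).
  by move=> a y /hQ[].
by apply: filterS2 up lo => w hu hl; exact: hausdorff_dim_eq hu hl.
Qed.

End RandomDimension.

Theorem theorem2p2 (R : realType) (d N M : nat)
  (hd : (1 <= d)%N) (hN : (2 <= N)%N) (hM : (2 <= M)%N)
  (f : 'I_N -> 'rV[R]_d -> 'rV[R]_d) (r : 'I_N -> R)
  (hr : forall i, 0 < r i < 1)
  (hf : forall i, similarity (r i) (f i))
  (hO : open_set_condition f)
  (p : 'I_N -> R) (hp : forall i, 0 < p i < 1) (hp1 : \sum_(i < N) p i = 1)
  (disp : measure_display) (T : measurableType disp) (Pr : probability T R)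
  (omega : edge M -> T -> 'I_N) (homega : iid_labels Pr p omega) :
  let F := fun w : T => random_subset f (fun e => omega e w) in
  let s0_eqn := fun s : R => \sum_(i < N) r i `^ s = 1 in
  let st_eqn := fun s : R => \sum_(i < N) p i * r i `^ s = M%:R^-1 in
  let hat_eqns := fun z : R * R =>
    \sum_(i < N) r i `^ z.1 * (M%:R * p i) `^ z.2 = 1 /\
    \sum_(i < N) r i `^ z.1 * (M%:R * p i) `^ z.2 * ln (M%:R * p i) = 0 in
  (exists! s0, s0_eqn s0) /\
  (exists! st, st_eqn st) /\
  forall s0 st : R, s0_eqn s0 -> st_eqn st ->
  [/\ (* (i) *)
      0 <= \sum_(i < N) r i `^ s0 * ln (M%:R * p i) ->
      {ae Pr, forall w, hausdorff_dim (F w) = s0%:E},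
      (* (ii) *)
      \sum_(i < N) p i * r i `^ st * ln (M%:R * p i) <= 0 ->
      [/\ {ae Pr, forall w, hausdorff_dim (F w) = st%:E},
          st <= s0
        & st = s0 <-> M = N /\ forall i, p i = N%:R^-1]
    & (* (iii) *)
      \sum_(i < N) r i `^ s0 * ln (M%:R * p i) < 0 ->
      0 < \sum_(i < N) p i * r i `^ st * ln (M%:R * p i) ->
      (exists! z : R * R, hat_eqns z) /\
      forall shat that : R, hat_eqns (shat, that) ->
      [/\ 0 < shat,
          {ae Pr, forall w, hausdorff_dim (F w) = shat%:E}
        & shat < s0]].
Proof.
move=> F s0_eqn st_eqn hat_eqns.
have hN0 : (0 < N)%N by exact: ltnW.
have MR : 0 < M%:R :> R by rewrite ltr0n ltnW.
have p0 i : 0 < p i by case/andP: (hp i).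
have r0 i : 0 < r i by case/andP: (hr i).
pose x i : R := M%:R * p i.
have x0 i : 0 < x i by rewrite mulr_gt0.
have s0E s : s0_eqn s <-> pressure r x s 0 = 1.
  rewrite /s0_eqn /pressure.
  by under [in X in _ <-> X]eq_bigr do rewrite powRr0 mulr1.
have p1E s : pressure r x s 1 = M%:R * \sum_(i < N) p i * r i `^ s.
  rewrite mulr_sumr; apply: eq_bigr => i _.
  by rewrite powRr1 ?(ltW (x0 i))// /x mulrC mulrA.
have stE s : st_eqn s <-> pressure r x s 1 = 1.
  rewrite /st_eqn p1E; split=> [->|h]; first by rewrite divff// gt_eqF.
  by apply: (mulfI (lt0r_neq0 MR)); rewrite h divff// gt_eqF.
have dt0E s : pressure_dt r x s 0 = \sum_(i < N) r i `^ s * ln (M%:R * p i).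
  by apply: eq_bigr => i _; rewrite powRr0 mulr1.
have dt1E s : pressure_dt r x s 1 = M%:R * \sum_(i < N) p i * r i `^ s * ln (M%:R * p i).
  rewrite mulr_sumr; apply: eq_bigr => i _.
  by rewrite powRr1 ?(ltW (x0 i))// /x; ring.
have dim s t := random_dim_ae hN0 hM hp1 p0 hr hf hO homega (s := s) (t := t).
split.
  have [|s [hs us]] := @sum_powR_root _ _ _ hr (fun=> 1) 1 hN0 _ ltr01; first by [].
  have e s' : \sum_(i < N) 1 * r i `^ s' = \sum_(i < N) r i `^ s'.
    by apply: eq_bigr => i _; rewrite mul1r.
  exists s; split; first by rewrite /s0_eqn -e.
  by move=> s'; rewrite /s0_eqn -e; exact: us.
split.
  by apply: (sum_powR_root hr hN0 p0); rewrite invr_gt0.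
move=> s0 st /s0E hs0 /stE hst.
have inj0 s s' : pressure r x s 0 = pressure r x s' 0 -> s = s'.
  move=> e; apply: (@sum_powR_inj _ _ _ hr (fun i => x i `^ 0) s s' hN0) => [i|].
    exact: powR_gt0.
  move: e; rewrite /pressure; under eq_bigr do rewrite mulrC.
  by under [RHS]eq_bigr do rewrite mulrC.
have ds s t := pressure_ds_lt0 hr x0 s t hN0.
have tg s t s' t' (e : pressure r x s t = pressure r x s' t') :=
  pressure_tangent_le hr x0 e.
(* At a nonpositive exponent every power of a ratio is at least 1. *)
have s00 : 0 < s0.
  rewrite ltNge; apply/negP => s0n.
  have : 1 < pressure r x s0 0.
    apply: (@lt_le_trans _ _ (\sum_(i < N) (1 : R))).
      by rewrite sumr_const card_ord ltr1n.
    apply: ler_sum => i _; rewrite powRr0 mulr1 -(powRr0 (r i)).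
    by apply: ger_powR => //; case/andP: (hr i) => -> /ltW ->.
  by rewrite hs0 ltxx.
have st0 : 0 < st.
  rewrite ltNge; apply/negP => stn.
  have : 1 < pressure r x st 1.
    rewrite p1E; apply: (@lt_le_trans _ _ (M%:R * 1)); first by rewrite mulr1 ltr1n.
    rewrite ler_pM2l// -hp1; apply: ler_sum => i _.
    rewrite -[leLHS]mulr1 ler_pM2l// -(powRr0 (r i)).
    by apply: ger_powR => //; case/andP: (hr i) => -> /ltW ->.
  by rewrite hst ltxx.
split.
- move=> h; apply: (dim s0 0) => //; first by rewrite lexx ler01.
  by rewrite mul0r lexx/= subr0 mul1r dt0E.
- move=> h.
  have dt1 : pressure_dt r x st 1 <= 0 by rewrite dt1E pmulr_rle0.
  have le : st <= s0.
    have := tg st 1 s0 0; rewrite hs0 hst => /(_ erefl).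
    rewrite sub0r mulN1r => hh; rewrite -subr_ge0 -(nmulr_lle0 _ (ds st 1)); lra.
  split=> //.
    apply: (dim st 1) => //; first by rewrite ler01 lexx.
    by rewrite mul1r subrr mul0r lexx andbT.
  split=> [e|[MN pN]].
    (* If st = s0 then the tangent plane at (st, 1) touches the pressure at (s0, 0),
       which forces ln x_i = 0 for every i. *)
    have [a b] := pressure_tangent hr x0 st 1 s0 0.
    move: a b; rewrite hs0 hst e subrr mul0r addr0 sub0r mulN1r => a b.
    have z : pressure_dt r x s0 1 = 0 by rewrite -e; move: a; rewrite -e; lra.
    move: b; rewrite z oppr0 addr0 eqxx => /esym/forallP b.
    have x1 i : x i = 1.
      have := b i; rewrite mul0r add0r mulN1r oppr_eq0 => /eqP h0.
      by rewrite -[LHS]lnK ?posrE// h0 expR0.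
    have pM i : p i = M%:R^-1.
      by apply: (mulfI (lt0r_neq0 MR)); rewrite divff ?gt_eqF//; exact: x1.
    have MN : M = N.
      move: hp1; under eq_bigr do rewrite pM.
      rewrite sumr_const card_ord -[LHS]mulr_natl => /(congr1 (fun u => u * M%:R)).
      by rewrite mul1r divfK ?gt_eqF// => /eqP; rewrite eqr_nat => /eqP.
    by split=> // i; rewrite pM MN.
  apply: inj0; rewrite hs0 -hst; apply: eq_bigr => i _.
  have -> : x i = 1 by rewrite /x pN MN divff// gt_eqF// -MN.
  by rewrite !powR1.
move=> h0 h1.
have dt0 : pressure_dt r x s0 0 < 0 by rewrite dt0E.
have dt1 : 0 < pressure_dt r x st 1 by rewrite dt1E mulr_gt0.
have [i xi] : exists i, x i < 1.
  apply: contrapT => nx; move: dt0; apply/negP; rewrite -leNgt.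
  apply: sumr_ge0 => i _; rewrite mulr_ge0 ?mulr_ge0 ?powR_ge0// ln_ge0//.
  by rewrite leNgt; apply/negP => xi; apply: nx; exists i.
have [k xk] : exists k, 1 < x k.
  apply: contrapT => nx; move: dt1; apply/negP; rewrite -leNgt.
  apply: sumr_le0 => k _; rewrite mulr_ge0_le0 ?mulr_ge0 ?powR_ge0// ln_le0//.
  by rewrite leNgt; apply/negP => xk; apply: nx; exists k.
have inj1 s : pressure r x s 1 = 1 -> s = st.
  move=> hs; have : st_eqn s by apply/stE.
  have : st_eqn st by apply/stE.
  by rewrite /st_eqn => <- /(sum_powR_inj hr hN0 p0).
split.
  have [||s [t [e1 e2]]] := critical_exists hr x0 hN0.
  - by move=> s hs; rewrite (inj0 s s0) // hs.
  - by move=> s /inj1 ->.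
  exists (s, t); split; first by split.
  move=> [s' t'] [/= e1' e2'].
  apply: (critical_unique hr x0 hN0 _ e1 e2 e1' e2').
  by exists i; rewrite lt_eqF.
move=> sh th [/= e1 e2].
have {}e1 : pressure r x sh th = 1 by [].
have {}e2 : pressure_dt r x sh th = 0 by [].
(* The tangent plane at the critical point is horizontal in t, so sh is the least
   value of s on the level curve. *)
have le0 : sh <= s0.
  have := tg sh th s0 0; rewrite e1 hs0 e2 mulr0 addr0 => /(_ erefl).
  by rewrite nmulr_lle0// subr_ge0.
have lt0 : sh < s0.
  rewrite lt_neqAle le0 andbT; apply/eqP => e; subst sh.
  have [_ b] := pressure_tangent hr x0 s0 th s0 0.
  move: b; rewrite e1 hs0 e2 subrr mul0r mulr0 !addr0 eqxx => /esym/forallP/(_ i).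
  rewrite mul0r add0r sub0r mulNr oppr_eq0 mulf_eq0 => /orP[/eqP t0|].
    by move: dt0; rewrite t0 in e2; rewrite e2 ltxx.
  by rewrite lt_eqF// ln_lt0// x0 xi.
have let1 : sh <= st.
  have := tg sh th st 1; rewrite e1 hst e2 mulr0 addr0 => /(_ erefl).
  by rewrite nmulr_lle0// subr_ge0.
(* The tangent planes at the ends of the level curve confine th to [0, 1]. *)
have th0 : 0 < th.
  have := tg s0 0 sh th; rewrite e1 hs0 => /(_ erefl); rewrite subr0 => hh.
  have : 0 < (sh - s0) * pressure_ds r x s0 0 by rewrite nmulr_lgt0// subr_lt0.
  move=> hh'; rewrite -(nmulr_llt0 _ dt0); lra.
have th1 : th <= 1.
  have := tg st 1 sh th; rewrite e1 hst => /(_ erefl) => hh.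
  have : 0 <= (sh - st) * pressure_ds r x st 1.
    by rewrite nmulr_lge0// subr_le0.
  move=> hh'; rewrite -subr_le0 -(pmulr_lle0 _ dt1); lra.
(* If sh <= 0 the term of an index k with x_k > 1 is already at least 1. *)
have sh0 : 0 < sh.
  rewrite ltNge; apply/negP => shn.
  have : 1 < pressure r x sh th.
    rewrite /pressure (bigD1 k)//= (bigD1 i)/=; last first.
      by apply/eqP => ik; move: xi; rewrite ik ltNge (ltW xk).
    have a1 : 1 <= r k `^ sh.
      rewrite -(powRr0 (r k)).
      by apply: ger_powR => //; case/andP: (hr k) => -> /ltW ->.
    have a2 : 1 <= x k `^ th by rewrite -(powRr0 (x k)) ler_powR// ltW.
    have a3 : 0 < r i `^ sh * x i `^ th by rewrite mulr_gt0 ?powR_gt0.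
    have a4 : 0 <= \sum_(j < N | (j != k) && (j != i)) r j `^ sh * x j `^ th.
      by apply: sumr_ge0 => j _; rewrite mulr_ge0 ?powR_ge0.
    have a5 : 1 <= r k `^ sh * x k `^ th by rewrite mulr_ege1.
    lra.
  by rewrite e1 ltxx.
split=> //; apply: (dim sh th) => //; first by rewrite (ltW th0).
by rewrite e2 !mulr0 lexx.
Qed.
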